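(* Let $\alpha\ge1$, let $T:\mathbb{S}\to\mathbb{S}$ be the intermittent circle map with parameter $\alpha$, and let $(\theta_\varepsilon)_{\varepsilon>0}$ be a family of absolutely continuous probability measures with $\operatorname{supp}\theta_\varepsilon\subset[-\varepsilon,\varepsilon]$, defining the additive random perturbation $T_t=T+t$. Let $(\mu^\varepsilon)_{\varepsilon>0}$ be the family of stationary probability measures of these random systems. Then $\mu^\varepsilon\to\delta_0$ in the weak$^*$ topology when $\varepsilon\to0$.
   Context: $\mathbb{S}=[0,1]/\{0\sim1\}$ is the circle with normalized Lebesgue measure $m$. The intermittent map with parameter $\alpha>0$ is $T(x)=x+2^{\alpha}x^{1+\alpha}$ for $x\in[0,1/2)$ and $T(x)=x-2^{\alpha}(1-x)^{1+\alpha}$ for $x\in[1/2,1]$, viewed as a map of $\mathbb{S}$; $0$ is a fixed point with $DT(0)=1$. $\delta_0$ is the Dirac mass at $0$. Additive perturbation: for $|t|\le 1/2$ let $T_t(x)=T(x)+t \pmod 1$. For small $\varepsilon>0$ (say $\varepsilon\le1/2$), $\theta_\varepsilon$ is a probability measure on the parameter interval $[-1/2,1/2]$, absolutely continuous with respect to Lebesgue measure, with support contained in $[-\varepsilon,\varepsilon]$. A Borel probability measure $\mu^\varepsilon$ on $\mathbb{S}$ is stationary for the random system if $\int\!\int\varphi(T_t(x))\,d\mu^\varepsilon(x)\,d\theta_\varepsilon(t)=\int\varphi\,d\mu^\varepsilon$ for all continuous $\varphi:\mathbb{S}\to\mathbb{R}$. In this setting a stationary probability measure $\mu^\varepsilon$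 exists for every $\varepsilon$, is ergodic, and is the unique absolutely continuous stationary probability measure. *)

(* Defs.v *)
From HB Require Import structures.
From mathcomp Require Import all_boot all_order all_algebra generic_quotient.
From mathcomp Require Import all_classical all_reals all_analysis.
Set Implicit Arguments.
Unset Strict Implicit.
Unset Printing Implicit Defensive.
Import Order.TTheory GRing.Theory Num.Theory.
Import numFieldNormedType.Exports.
Local Open Scope classical_set_scope.
Local Open Scope ring_scope.
Local Open Scope quotient_scope.

Section circle.
Context (R : realType).

Definition unit_itv : set R := `[0, 1].

Definition endpoint (x : unit_itv) := (val x == 0) || (val x == 1).

Definition glue (x y : unit_itv) := (x == y) || (endpoint x && endpoint y).

Lemma glue_refl : reflexive glue.
Proof. by move=> x; rewrite /glue eqxx. Qed.

Lemma glue_sym : symmetric glue.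
Proof. by move=> x y; rewrite /glue eq_sym andbC. Qed.

Lemma glue_trans : transitive glue.
Proof.
move=> y x z /orP[/eqP-> //|/andP[ex ey]] /orP[/eqP<-|/andP[_ ez]].
  by rewrite /glue ex ey orbT.
by rewrite /glue ex ez orbT.
Qed.

Canonical glue_equiv := EquivRel glue glue_refl glue_sym glue_trans.

Definition circle := {eq_quot glue}.

HB.instance Definition _ := Topological.copy circle (quotient_topology circle).
HB.instance Definition _ := Quotient.on circle.

Lemma frac_unit_itv (r : R) : r - (Num.floor r)%:~R \in unit_itv.
Proof.
rewrite inE /unit_itv /= in_itv /= subr_ge0 Num.Theory.floor_le /= lerBlDr.
by rewrite addrC; have /ltW := floorD1_gt r; rewrite rmorphD.
Qed.

Definition circle_of (r : R) : circle := \pi_circle (SigSub (frac_unit_itv r)).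

HB.instance Definition _ := isPointed.Build circle (circle_of 0).

HB.instance Definition _ :=
  Measurable.copy circle (g_sigma_algebraType (@open circle)).

(* a representative in [0, 1]; at the base point it is unspecified whether it
   is 0 or 1 *)
Definition coord (x : circle) : R := val (repr x).

Lemma circle_of_val (x : unit_itv) : circle_of (val x) = \pi_circle x.
Proof.
apply/eqmodP; rewrite /= /glue.
have := set_valP x; rewrite /unit_itv /= in_itv /= => /andP[x0].
rewrite le_eqVlt => /orP[/eqP x1|x1].
  apply/orP; right; rewrite /endpoint /= x1 eqxx orbT andbT.
  by rewrite (@floor_def _ 1 1) ?subrr ?eqxx// lexx/= ltr1n.
apply/orP; left; apply/eqP/val_inj => /=.
by rewrite (@floor_def _ _ 0) ?subr0// x0.
Qed.

Lemma coordK : cancel coord circle_of.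
Proof. by move=> x; rewrite /coord circle_of_val reprK. Qed.

Definition intermittent_fun (alpha x : R) : R :=
  if x < 2^-1 then x + 2 `^ alpha * x `^ (1 + alpha)
  else x - 2 `^ alpha * (1 - x) `^ (1 + alpha).

Definition intermittent (alpha : R) (x : circle) : circle :=
  circle_of (intermittent_fun alpha (coord x)).

(* the choice of representative in [coord] is immaterial *)
Lemma intermittentE (alpha : R) (x : unit_itv) : 0 < alpha ->
  intermittent alpha (\pi_circle x) = circle_of (intermittent_fun alpha (val x)).
Proof.
move=> a0.
have a1 : (1 + alpha == 0) = false by apply/negbTE; rewrite gt_eqF// addr_gt0.
have T0 : intermittent_fun alpha 0 = 0.
  by rewrite /intermittent_fun invr_gt0 ltr0n powR0 ?a1// mulr0 addr0.
have T1 : intermittent_fun alpha 1 = 1.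
  rewrite /intermittent_fun ltNge invf_le1 ?ltr0n// ler1n/=.
  by rewrite subrr powR0 ?a1// mulr0 subr0.
have c01 : circle_of 0 = circle_of 1.
  have i0 : (0 : R) \in unit_itv by rewrite inE /unit_itv /= in_itv /= lexx ler01.
  have i1 : (1 : R) \in unit_itv by rewrite inE /unit_itv /= in_itv /= lexx ler01.
  rewrite (circle_of_val (SigSub i0)) (circle_of_val (SigSub i1)).
  by apply/eqmodP; rewrite /= /glue /endpoint /= !eqxx !orbT.
rewrite /intermittent /coord.
have /eqmodP : \pi_circle (repr (\pi_circle x)) = \pi_circle x by rewrite reprK.
rewrite /= => /orP[/eqP-> //|/andP[]].
by move=> /orP[]/eqP-> /orP[]/eqP->; rewrite ?T0 ?T1.
Qed.

Definition additive_perturbation (alpha t : R) (x : circle) : circle :=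
  circle_of (coord (intermittent alpha x) + t).

Definition msupport (nu : set R -> \bar R) : set R :=
  [set x | forall U, open U -> U x -> (0 < nu U)%E].

Definition stationary (theta : probability (measurableTypeR R) R)
    (T : R -> circle -> circle) (mu : probability circle R) : Prop :=
  forall phi : circle -> R, continuous phi ->
    \int[theta]_t \int[mu]_x phi (T t x) = \int[mu]_x phi x.

Definition weak_star_cvg (I : Type) (F : set_system I)
    (mu : I -> probability circle R) (nu : probability circle R) : Prop :=
  forall phi : circle -> R, continuous phi ->
    \int[mu i]_x phi x @[i --> F] --> \int[nu]_x phi x.

End circle.

(* Main.v *)
Require Import Defs.
From HB Require Import structures.
From mathcomp Require Import all_boot all_order all_algebra generic_quotient.
From mathcomp Require Import all_classical all_reals all_analysis.
From mathcomp Require Import measurable_realfun ring lra.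
Import Order.TTheory GRing.Theory Num.Theory.
Import numFieldNormedType.Exports.
Set Implicit Arguments.
Unset Strict Implicit.
Unset Printing Implicit Defensive.
Local Open Scope classical_set_scope.
Local Open Scope ring_scope.
Local Open Scope quotient_scope.

(** Let [kappa] be a stationary measure of the randomly perturbed map and let
    [L] be the transfer operator of the unperturbed map [T], acting on densities
    with respect to Lebesgue measure.  The proof tests [kappa] against one
    well-chosen positive function [u].

    The first ingredient is an entropy inequality ([entropy_inequality]).  If
    [exp (psi (y + t)) * L u y <= u (y + t)] for every noise value [t], then the
    product of the weights [exp psi] along the first [n] steps of the random
    orbit has a bounded expectation when the initial point is distributed as [u]
    times Lebesgue measure.  Hence, for every [c > 0], its conditional
    expectation given the initial point is at most [exp (n c)] outside a set
    whose Lebesgue measure is exponentially small.  Absolute continuity of the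
    noise is what transfers this to [kappa]: one step of the noise spreads every
    point over a measure dominated by Lebesgue measure, which by Borel-Cantelli
    cannot keep a fixed mass on such small sets.  With Jensen's inequality, the
    mean of [psi] under [kappa] is at most [0].

    The second ingredient is a deterministic function [u] ([supersolution]):
    the truncated resolvent [\sum_(k < N) s ^+ k * (L ^ k 1)] with [s < 1] close
    to [1] and [N] large.  It satisfies [s * L u <= u - 1 / 2], a margin that
    absorbs a small noise ([supersolution_noise]), so that the entropy
    inequality applies to [psi = ln s + 1 / (4 u)] and gives
    [\int 1 / u <= - 4 * ln s], of order [1 - s] ([mass_away]).  It remains to
    see that [(1 - s) * u] is small away from the neutral point, for then [kappa]
    gives little mass to that region.

    This is where [alpha >= 1] enters.  The iterates [L ^ k 1], hence [u], lie
    in a cone of functions [f], symmetric under [x |-> 1 - x], for which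
    [x ^ B * f x] increases ([in_cone_transfer]); away from [0] they are
    therefore comparable with their value at [1/2].  Let [a_0 = 1] and let
    [a_(k+1)] be the preimage of [a_k] under the left branch.  The preimage of
    [[0, a_k]] is [[0, a_(k+1)]] together with an interval at [1/2] of length
    comparable to [a_k], so that summing over [k] the mass of [u] is at least a
    multiple of [u (1/2) * \sum_k s ^ (k + 1) a_k] ([Rintegral_escape]).  This
    mass is at most [1 / (1 - s)], whereas [a_k >= 1 / (2 k + 1)] because the
    branch moves [x] by at most [2 x ^ 2] ([backward_ge]).  As the harmonic
    series diverges, [(1 - s) * u (1/2)] tends to [0] as [s] tends to [1].

    The circle is handled through continuous [1]-periodic functions on the line;
    [clift] represents [T] on the unit interval. *)

(** * Periodic functions on the line *)

Section periodic.
Context {R : realType}.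
Implicit Types (f g h : R -> R) (x y t : R).

Definition fpart x : R := x - (Num.floor x)%:~R.

Definition one_periodic f := forall x, f (x + 1) = f x.

Lemma fpart_ge0 x : 0 <= fpart x.
Proof. by rewrite /fpart subr_ge0 Num.Theory.floor_le. Qed.

Lemma fpart_lt1 x : fpart x < 1.
Proof. by rewrite /fpart ltrBlDr addrC; have := floorD1_gt x; rewrite rmorphD. Qed.

Lemma fpart_id x : 0 <= x < 1 -> fpart x = x.
Proof. by move=> x01; rewrite /fpart (@floor_def _ _ 0) ?subr0// add0r. Qed.

Lemma fpart1 : fpart 1 = 0 :> R.
Proof. by rewrite /fpart (@floor_def _ _ 1) ?subrr// lexx ltr1n. Qed.

Lemma fpartD1 x : fpart (x + 1) = fpart x.
Proof.
rewrite /fpart floorDrz ?rpred1// floor1 rmorphD/= [X in _ - X]addrC opprD.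
by rewrite addrA addrK.
Qed.

Lemma periodicDn f (pf : one_periodic f) (n : nat) x : f (x + n%:R) = f x.
Proof.
elim: n => [|n IH]; first by rewrite addr0.
by rewrite -natr1 addrA pf.
Qed.

Lemma periodicDz f (pf : one_periodic f) (n : int) x : f (x + n%:~R) = f x.
Proof.
case: n => n; first exact: periodicDn.
by rewrite NegzE -[LHS](periodicDn pf n.+1) mulrNz -pmulrn subrK.
Qed.

Lemma periodic_fpart f x : one_periodic f -> f (fpart x) = f x.
Proof. by move=> pf; rewrite /fpart -mulrNz periodicDz. Qed.

Definition clamp x := Num.max 0 (Num.min 1 x).

Lemma clampE x : clamp x = if x <= 0 then 0 else if 1 <= x then 1 else x.
Proof.
rewrite /clamp; have [x1|x1] := leP 1 x.
  have -> : (x <= 0) = false by apply: lt_geF; lra.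
  by have [|] := leP 0 (1 : R); lra.
by have [x0|x0] := leP 0 x; have [x0'|x0'] := leP x 0; lra.
Qed.

Lemma clamp_itv x : 0 <= clamp x <= 1.
Proof. by rewrite clampE; have [] := leP x 0; have [] := leP 1 x; lra. Qed.

Lemma clamp_id x : 0 <= x <= 1 -> clamp x = x.
Proof. by rewrite clampE; have [] := leP x 0; have [] := leP 1 x; lra. Qed.

Lemma continuous_clamp : continuous clamp.
Proof.
move=> x; apply: continuous_max; first exact: cvg_cst.
by apply: continuous_min => //; exact: cvg_cst.
Qed.

(** Near an integer [n], freezing [h] outside the unit interval gives
    [h (fpart x) = h (x - n) + h (x - n + 1) - h 0], because one of the first two
    terms is then [h 0 = h 1]; the right-hand side is visibly continuous. *)
Lemma continuous_fpart h : continuous h -> h 0 = h 1 ->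
  continuous (h \o fpart).
Proof.
move=> ch h01 x.
set n := Num.floor x.
pose k y := h (clamp (y - n%:~R)) + h (clamp (y + (1 - n%:~R))) - h 0.
have ck : continuous k.
  have hc c : continuous (fun y => h (clamp (y + c))).
    move=> y; apply: (@continuous_comp _ _ _ (fun y => clamp (y + c)) h); last exact: ch.
    apply: (@continuous_comp _ _ _ (fun y => y + c) clamp); last exact: continuous_clamp.
    by apply: cvgD; [exact: cvg_id|exact: cvg_cst].
  move=> y; apply: cvgB; last exact: cvg_cst.
  apply: cvgD; first exact: hc.
  exact: hc.
have xn : n%:~R <= x < (n + 1)%:~R by exact: floor_itv.
have hk y : n%:~R - 1 < y -> y < (n + 1)%:~R -> h (fpart y) = k y.
  rewrite rmorphD/= => y1 y2; rewrite /k !clampE.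
  have [yn|yn] := leP (n%:~R) y.
    rewrite /fpart (@floor_def _ _ n); last by rewrite rmorphD/= yn.
    have -> : (1 <= y + (1 - n%:~R)) by lra.
    have -> : (1 <= y - n%:~R) = false by apply: lt_geF; lra.
    have -> : (y + (1 - n%:~R) <= 0) = false by apply: lt_geF; lra.
    case: ifPn => [y0|_]; last by rewrite h01; lra.
    have -> : y - n%:~R = 0 by lra.
    by rewrite h01; lra.
  rewrite /fpart (@floor_def _ _ (n - 1)); last first.
    by rewrite subrK rmorphB/=; lra.
  have -> : (y - n%:~R <= 0) by lra.
  have -> : (1 <= y + (1 - n%:~R)) = false by apply: lt_geF; lra.
  have -> : (y + (1 - n%:~R) <= 0) = false by apply: lt_geF; lra.
  by rewrite rmorphB/= opprB; lra.
rewrite /continuous_at/= (hk x); [|by move: xn; rewrite rmorphD/=; lra|by case/andP: xn].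
apply: (@cvg_trans _ (k y @[y --> x])); last exact: ck.
apply: near_eq_cvg; near=> y; rewrite /= hk//.
- by near: y; apply: lt_nbhsr; lra.
- by near: y; apply: lt_nbhsl; lra.
Unshelve. all: by end_near. Qed.

Lemma periodic_comp_fpart h : one_periodic (h \o fpart).
Proof. by move=> x; rewrite /= fpartD1. Qed.

Lemma comp_fpart_id h x : h 0 = h 1 -> 0 <= x <= 1 -> h (fpart x) = h x.
Proof.
move=> h01 /andP[x0]; rewrite le_eqVlt => /predU1P[->|x1]; first by rewrite fpart1.
by rewrite fpart_id// x0.
Qed.

Lemma periodic_bounded f : continuous f -> one_periodic f ->
  exists2 M, 0 < M & forall x, `|f x| <= M.
Proof.
move=> cf pf.
have [||c c01 hc] := @EVT_max R (fun x => `|f x|) 0 1 => //.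
  apply: continuous_subspaceT => x; apply: continuous_comp; first exact: cf.
  exact: norm_continuous.
exists (`|f c| + 1); first by rewrite ltr_wpDl.
move=> x; rewrite -(periodic_fpart x pf).
have /hc : fpart x \in `[0, 1].
  by rewrite in_itv/= fpart_ge0/= ltW// fpart_lt1.
by move=> /le_trans; apply; lra.
Qed.

(** Heine's theorem, by compactness of the unit interval. *)
Lemma periodic_unif_continuous f : continuous f -> one_periodic f ->
  forall e, 0 < e -> exists2 d, 0 < d &
    forall x t, `|t| <= d -> `|f (x + t) - f x| < e.
Proof.
move=> cf pf e e0.
have /compact_near_coveringP/near_covering_withinP cov := @segment_compact R 0 1.
have := cov R (nbhs (0 : R)) (fun t x => `|f (x + t) - f x| < e) _.
case=> [x x01|d/= d0 hd].
  have h : {for (x, 0 : R), continuous (fun p : R * R => f (p.1 + p.2) - f p.1)}.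
    apply: (@continuousB _ R^o).
      apply: continuous_comp; last exact: cf.
      by apply: (@continuousD _ R^o); [exact: cvg_fst|exact: cvg_snd].
    by apply: continuous_comp; [exact: cvg_fst|exact: cf].
  move/cvgr_dist_lt : h => /(_ _ e0) /=; rewrite addr0 subrr.
  rewrite near_simpl; case=> -[A B]/= [nA nB] AB.
  exists (A, B) => // -[y t] /= [Ay Bt] _.
  by have /= := AB (y, t) (conj Ay Bt); rewrite sub0r normrN.
exists (d / 2); first by rewrite divr_gt0.
move=> x t td.
have -> : f (x + t) = f (fpart x + t).
  by rewrite /fpart -mulrNz addrAC periodicDz.
rewrite -(periodic_fpart x pf); apply: hd => /=; last first.
  by rewrite in_itv/= fpart_ge0/= ltW// fpart_lt1.
by rewrite sub0r normrN (le_lt_trans td)// ltr_pdivrMr// ltr_pMr// ltr1n.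
Qed.

End periodic.

(** * Integrals over segments *)

Section segment_integral.
Context {R : realType}.
Notation leb := (@lebesgue_measure R).
Implicit Types (f g : R -> R) (a b c x y t : R).

Lemma continuous_integrable_itv f a b : continuous f ->
  leb.-integrable `[a, b] (EFin \o f).
Proof.
move=> cf; apply: continuous_compact_integrable; first exact: segment_compact.
exact: continuous_subspaceT.
Qed.

Lemma Rintegral_itv_cat f a b c : continuous f -> a <= b -> b <= c ->
  \int[leb]_(x in `[a, c]) f x =
  \int[leb]_(x in `[a, b]) f x + \int[leb]_(x in `[b, c]) f x.
Proof.
move=> cf ab bc.
have := @Rintegral_itvB R f (BLeft a) (BRight c) b (continuous_integrable_itv _ _ cf).
rewrite !bnd_simp => /(_ ab bc) /eqP; rewrite subr_eq => /eqP ->.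
rewrite addrC Rintegral_itv_obnd_cbnd//.
apply: integrableS (continuous_integrable_itv b c cf) => //.
by apply: subset_itvr; rewrite bnd_simp.
Qed.

Lemma le_Rintegral_itv f g a b : continuous f -> continuous g ->
  (forall x, a <= x <= b -> f x <= g x) ->
  \int[leb]_(x in `[a, b]) f x <= \int[leb]_(x in `[a, b]) g x.
Proof.
move=> cf cg fg; apply: le_Rintegral => //; try exact: continuous_integrable_itv.
Qed.

Lemma Rintegral_itv_shift f a b t : continuous f -> a <= b ->
  \int[leb]_(x in `[a, b]) f (x + t) = \int[leb]_(x in `[a + t, b + t]) f x.
Proof.
move=> cf ab.
have dF : derive1 (fun x : R => x + t) = cst 1.
  apply/funext => x; rewrite derive1E deriveD//.
  by rewrite derive_id derive_cst addr0.
rewrite [RHS]/Rintegral (@integration_by_substitution_increasing R (fun x => x + t) f)//.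
- by congr fine; apply: eq_integral => x _; rewrite dF fctE /= mulr1.
- by move=> x y _ _; rewrite ltrD2r.
- by rewrite dF => x _; exact: cvg_cst.
- by rewrite dF; exact: is_cvg_cst.
- by rewrite dF; exact: is_cvg_cst.
- split.
  + by move=> x _; apply: derivableD.
  + apply: cvg_at_right_filter; apply: cvgD; [exact: cvg_id|exact: cvg_cst].
  + apply: cvg_at_left_filter; apply: cvgD; [exact: cvg_id|exact: cvg_cst].
- exact: continuous_subspaceT.
Qed.

Lemma continuous_translate f t : continuous f -> continuous (fun x => f (x + t)).
Proof.
move=> cf y; apply: (@continuous_comp _ _ _ (fun y => y + t) f); last exact: cf.
by apply: cvgD; [exact: cvg_id|exact: cvg_cst].
Qed.

Lemma Rintegral_periodic_shift f t : continuous f -> one_periodic f ->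
  \int[leb]_(x in `[0, 1]) f (x + t) = \int[leb]_(x in `[0, 1]) f x.
Proof.
move=> cf pf.
have -> : \int[leb]_(x in `[0, 1]) f (x + t) = \int[leb]_(x in `[0, 1]) f (x + fpart t).
  apply: eq_Rintegral => x _; rewrite /fpart -mulrNz addrA periodicDz//.
have := fpart_ge0 t; have /ltW := fpart_lt1 t; move: (fpart t) => s s1 s0.
rewrite Rintegral_itv_shift// add0r.
rewrite (@Rintegral_itv_cat _ s 1)//; last by rewrite lerDl.
rewrite addrC [RHS](@Rintegral_itv_cat _ 0 s)//; congr (_ + _).
rewrite -[X in `[X, _]]add0r [X in `[_, X]]addrC -[X in `[X, _]]addrC addr0.
transitivity (\int[leb]_(x in `[0, s]) f (x + 1)); last first.
  by apply: eq_Rintegral => x _; exact: pf.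
by rewrite Rintegral_itv_shift// add0r addrC.
Qed.

Lemma continuous_onem f : continuous f -> continuous (fun x => f (1 - x)).
Proof.
move=> cf y; apply: (@continuous_comp _ _ _ (fun y => 1 - y) f); last exact: cf.
by apply: cvgB; [exact: cvg_cst|exact: cvg_id].
Qed.

Lemma Rintegral_itv_onem f a : continuous f -> 0 <= a <= 1 ->
  \int[leb]_(x in `[0, a]) f x = \int[leb]_(x in `[1 - a, 1]) f (1 - x).
Proof.
move=> cf a01; rewrite Rintegration_by_substitution_onem//.
exact: continuous_subspaceT.
Qed.

Lemma Rintegral_itv_cst a b c : a <= b ->
  \int[leb]_(x in `[a, b]) c = c * (b - a).
Proof.
move=> ab; rewrite Rintegral_cst//= lebesgue_measure_itv/= lte_fin.
case: ltP => // ba; have -> : b = a by lra.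
by rewrite subrr.
Qed.

End segment_integral.

(** * The left branch of the map *)

Section branch.
Context {R : realType}.
Variable alpha : R.
Hypothesis alpha1 : 1 <= alpha.
Notation leb := (@lebesgue_measure R).
Implicit Types (f g : R -> R) (a b x y t : R).

(** The relative displacement of the left branch.  Freezing it at [0] for
    negative [x] makes [branch] an increasing bijection of the whole line, so
    that its inverse is total and continuous. *)
Definition excess x : R := (2 * Num.max 0 x) `^ alpha.

Definition branch x : R := x * (1 + excess x).

Definition dbranch x : R := 1 + (1 + alpha) * excess x.

Let alpha_gt0 : 0 < alpha. Proof. by rewrite (lt_le_trans _ alpha1). Qed.
Let alpha_neq0 : alpha != 0. Proof. exact: lt0r_neq0. Qed.

Lemma excess_ge0 x : 0 <= excess x. Proof. exact: powR_ge0. Qed.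

Lemma excess_le0 x : x <= 0 -> excess x = 0.
Proof. by move=> x0; rewrite /excess max_l// mulr0 powR0. Qed.

Lemma le_excess x y : x <= y -> excess x <= excess y.
Proof.
move=> xy; rewrite /excess; apply: ge0_ler_powR; rewrite ?nnegrE.
- exact: ltW.
- by rewrite mulr_ge0// le_max lexx.
- by rewrite mulr_ge0// le_max lexx.
- by rewrite ler_pM2l// le_max2.
Qed.

Lemma excess_half : excess 2^-1 = 1.
Proof. by rewrite /excess max_r ?invr_ge0// divff// powR1. Qed.

Lemma excess_le x : 0 <= x <= 2^-1 -> excess x <= 2 * x.
Proof.
move=> /andP[]; rewrite le_eqVlt => /predU1P[<- _|x0 x1].
  by rewrite excess_le0// mulr0.
rewrite /excess max_r; last exact: ltW.
apply: ge1r_powR => //.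
by apply/andP; split; lra.
Qed.

Lemma excessE x : 0 <= x -> x * excess x = 2 `^ alpha * x `^ (1 + alpha).
Proof.
move=> x0; rewrite /excess max_r// powRM//.
have a1 : 0 < 1 + alpha by (have := alpha1; lra).
by rewrite -(mulr_powRB1 x0 a1) [1 + alpha]addrC addrK mulrCA.
Qed.

Lemma continuous_excess : continuous excess.
Proof.
move=> x; have [x0|x0|->] := ltgtP x 0.
- rewrite /continuous_at (excess_le0 (ltW x0)).
  apply: cvg_near_cst; near=> y; apply: excess_le0.
  by apply: ltW; near: y; exact: lt_nbhsl.
- have dx : derivable (fun y : R => y `^ alpha) (2 * x) 1.
    by apply: derivable_powR; rewrite in_itv/= andbT mulr_gt0.
  have /derivable1_diffP/differentiable_continuous cx := dx.
  have : {for x, continuous (fun y => (2 * y) `^ alpha)}.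
    apply: (@continuous_comp _ _ _ (fun y : R => 2 * y) (fun y : R => y `^ alpha)) => //.
    by apply: cvgM; [exact: cvg_cst|exact: cvg_id].
  rewrite /continuous_at => h.
  have -> : excess x = (2 * x) `^ alpha by rewrite /excess max_r// ltW.
  apply: cvg_trans h; apply: near_eq_cvg; near=> y.
  rewrite /excess max_r//; apply: ltW; near: y; exact: lt_nbhsr.
- rewrite /continuous_at excess_le0//.
  apply/cvgrPdist_lt => e e0; near=> y.
  rewrite sub0r normrN ger0_norm ?excess_ge0//.
  have [y0|y0] := leP y 0; first by rewrite excess_le0.
  have ye : y < e / 2 by near: y; apply: lt_nbhsl; lra.
  have y2 : y < 2^-1 by near: y; apply: lt_nbhsl; lra.
  by apply: le_lt_trans (excess_le _) _; lra.
Unshelve. all: by end_near. Qed.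

Lemma continuous_branch : continuous branch.
Proof.
move=> x; apply: cvgM; first exact: cvg_id.
by apply: cvgD; [exact: cvg_cst|exact: continuous_excess].
Qed.

Lemma continuous_dbranch : continuous dbranch.
Proof.
move=> x; apply: cvgD; first exact: cvg_cst.
by apply: cvgM; [exact: cvg_cst|exact: continuous_excess].
Qed.

Lemma dbranch_ge1 x : 1 <= dbranch x.
Proof. by rewrite lerDl mulr_ge0 ?excess_ge0// addr_ge0// ltW. Qed.

Lemma dbranch_gt0 x : 0 < dbranch x.
Proof. by rewrite (lt_le_trans _ (dbranch_ge1 x)). Qed.

Lemma is_derive_branch x : is_derive x 1 branch (dbranch x).
Proof.
have [x0|x0|->] := ltgtP x 0.
- have -> : dbranch x = 1 by rewrite /dbranch excess_le0 ?ltW//; lra.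
  apply: (@near_eq_is_derive _ _ _ id) => //.
  near=> y; rewrite /branch excess_le0; first by rewrite addr0 mulr1.
  by apply: ltW; near: y; exact: lt_nbhsl.
- have dp : is_derive x 1 (fun y => y `^ (1 + alpha)) ((1 + alpha) * x `^ alpha).
    have xi : x \in `]0, +oo[ by rewrite in_itv/= x0.
    apply: DeriveDef; first exact: derivable_powR.
    rewrite -derive1E powR_derive1//.
    by have -> : 1 + alpha - 1 = alpha by lra.
  have -> : dbranch x = 1 + 2 `^ alpha * ((1 + alpha) * x `^ alpha).
    by rewrite /dbranch /excess max_r ?ltW// powRM ?ltW//; lra.
  apply: (@near_eq_is_derive _ _ _ (fun y => y + 2 `^ alpha * y `^ (1 + alpha))) => //.
  + near=> y; have y0 : 0 <= y by apply: ltW; near: y; exact: lt_nbhsr.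
    by rewrite -excessE// /branch; lra.
- have -> : dbranch 0 = 1 by rewrite /dbranch excess_le0//; lra.
  have h : (fun h : R => h^-1 *: (branch (h *: 1 + 0) - branch 0)) @ 0^' --> (1 : R).
    apply: (@cvg_trans _ ((fun h => 1 + excess h) @ 0^')).
      apply: near_eq_cvg; near=> h.
      have h0 : h != 0 by near: h; exact: nbhs_dnbhs_neq.
      by rewrite addr0 /branch mul0r subr0 [h *: 1]mulr1 [RHS]mulrA mulVf// mul1r.
    have /= h1 := cvgD (cvg_cst (1 : R)) (@continuous_excess 0).
    rewrite excess_le0// addr0 in h1.
    by apply: cvg_within_filter; exact: h1.
  by apply: DeriveDef; [apply/cvg_ex; exists 1|exact: cvg_lim h].
Unshelve. all: by end_near. Qed.

Lemma derive1_branch : derive1 branch = dbranch.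
Proof.
by apply/funext => x; rewrite derive1E; have [_] := is_derive_branch x.
Qed.

Lemma branch0 : branch 0 = 0. Proof. by rewrite /branch mul0r. Qed.

Lemma branch_half : branch 2^-1 = 1.
Proof. by rewrite /branch excess_half; lra. Qed.

(** Expansion of the branch; it makes the inverse branch a contraction, whose
    continuity is then immediate. *)
Lemma branch_expand x y : x <= y -> y - x <= branch y - branch x.
Proof.
move=> xy; rewrite /branch !mulrDr !mulr1.
suff : x * excess x <= y * excess y by lra.
have [y0|y0] := leP y 0.
  by rewrite !excess_le0// ?mulr0// (le_trans xy).
have [x0|x0] := leP x 0.
  by rewrite (excess_le0 x0) mulr0 mulr_ge0 ?excess_ge0// ltW.
by apply: ler_pM => //; [exact: ltW|exact: excess_ge0|exact: le_excess].
Qed.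

Lemma branch_lt x y : x < y -> branch x < branch y.
Proof. by move=> xy; have := branch_expand (ltW xy); lra. Qed.

Lemma branch_inj : injective branch.
Proof.
by move=> x y; have [/branch_lt|/branch_lt|//] := ltgtP x y; lra.
Qed.

Lemma branch_surj y : exists x, branch x == y.
Proof.
have [y0|y0] := leP y 0.
  by exists y; rewrite /branch excess_le0// addr0 mulr1.
have [||x _ <-] := @IVT R branch 0 y y (ltW y0).
- exact: continuous_subspaceT continuous_branch.
- have yb : y <= branch y by have := branch_expand (ltW y0); rewrite branch0; lra.
  by rewrite branch0 ge_min ltW//= le_max yb orbT.
- by exists x.
Qed.

Definition ibranch y : R := xchoose (branch_surj y).

Lemma ibranchK : cancel ibranch branch.
Proof. by move=> y; exact/eqP/(xchooseP (branch_surj y)). Qed.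

Lemma branchK : cancel branch ibranch.
Proof. by move=> y; apply: branch_inj; rewrite ibranchK. Qed.

Lemma ibranch0 : ibranch 0 = 0.
Proof. by apply: branch_inj; rewrite ibranchK branch0. Qed.

Lemma ibranch1 : ibranch 1 = 2^-1.
Proof. by apply: branch_inj; rewrite ibranchK branch_half. Qed.

Lemma le_branch x y : (branch x <= branch y) = (x <= y).
Proof.
have [xy|/branch_lt/lt_geF//] := leP x y.
by have := branch_expand xy; lra.
Qed.

Lemma le_ibranch x y : (ibranch x <= ibranch y) = (x <= y).
Proof. by rewrite -le_branch !ibranchK. Qed.

Lemma ibranch_ge0 y : (0 <= ibranch y) = (0 <= y).
Proof. by rewrite -{1}ibranch0 le_ibranch. Qed.

Lemma ibranch_le_half y : (ibranch y <= 2^-1) = (y <= 1).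
Proof. by rewrite -ibranch1 le_ibranch. Qed.

Lemma ibranch_itv y : 0 <= y <= 1 -> 0 <= ibranch y <= 2^-1.
Proof. by rewrite ibranch_ge0 ibranch_le_half. Qed.

Lemma ibranch_contract x y : `|ibranch x - ibranch y| <= `|x - y|.
Proof.
wlog xy : x y / x <= y.
  move=> h; have [|yx] := leP x y; first exact: h.
  by rewrite (distrC x) (distrC (ibranch _)); apply: h; exact: ltW.
have := branch_expand (x := ibranch x) (y := ibranch y).
rewrite le_ibranch => /(_ xy); rewrite !ibranchK.
by rewrite !ler0_norm ?subr_le0 ?le_ibranch//; lra.
Qed.

Lemma continuous_ibranch : continuous ibranch.
Proof.
move=> x; apply/cvgrPdist_lt => e e0; near=> y.
apply: le_lt_trans (ibranch_contract x y) _.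
by near: y; apply: cvgr_dist_lt => //; exact: cvg_id.
Unshelve. all: by end_near. Qed.

Lemma Rintegral_ibranch f a b : continuous f -> a <= b ->
  \int[leb]_(y in `[branch a, branch b]) (f (ibranch y) / dbranch (ibranch y)) =
  \int[leb]_(x in `[a, b]) f x.
Proof.
move=> cf ab; rewrite [LHS]/Rintegral.
have := @integration_by_substitution_increasing R branch
  (fun y => f (ibranch y) / dbranch (ibranch y)) a b ab.
rewrite derive1_branch => ->.
- congr fine; apply: eq_integral => x _; rewrite fctE/= branchK.
  by rewrite divfK// gt_eqF// dbranch_gt0.
- by move=> x y _ _; exact: branch_lt.
- by move=> x _; exact: continuous_dbranch.
- by apply/cvg_ex; exists (dbranch a); apply: cvg_at_right_filter; exact: continuous_dbranch.
- by apply/cvg_ex; exists (dbranch b); apply: cvg_at_left_filter; exact: continuous_dbranch.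
- split.
  + by move=> x _; have [] := is_derive_branch x.
  + by apply: cvg_at_right_filter; exact: continuous_branch.
  + by apply: cvg_at_left_filter; exact: continuous_branch.
- apply: continuous_subspaceT => y.
  apply: (@continuous_comp _ _ _ ibranch (fun x => f x / dbranch x)).
    exact: continuous_ibranch.
  apply: cvgM; first exact: cf.
  apply: cvgV; last exact: continuous_dbranch.
  by rewrite gt_eqF// dbranch_gt0.
Qed.

End branch.

(** * The transfer operator and its invariant cone *)

Section transfer.
Context {R : realType}.
Variable alpha : R.
Hypothesis alpha1 : 1 <= alpha.
Notation leb := (@lebesgue_measure R).
Notation excess := (excess alpha).
Notation branch := (branch alpha).
Notation dbranch := (dbranch alpha).
Notation z := (ibranch alpha1).
Implicit Types (f g : R -> R) (a b x y t : R).

(** A continuous lift of the circle map to the unit interval, with values in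
    [[0, 2]].  The minima switch off one of the two branches, which avoids a
    definition by cases. *)
Definition clift x : R :=
  branch (Num.min x 2^-1) - branch (Num.min (1 - x) 2^-1) + 1.

Lemma clift_left x : x <= 2^-1 -> clift x = branch x.
Proof.
move=> x2; rewrite /clift min_l// min_r; last by lra.
by rewrite branch_half; lra.
Qed.

Lemma clift_right x : 2^-1 <= x -> clift x = 1 - branch (1 - x) + 1.
Proof.
move=> x2; rewrite /clift min_r// min_l; last by lra.
by rewrite branch_half; lra.
Qed.

Lemma clift0 : clift 0 = 0.
Proof. by rewrite clift_left ?branch0// invr_ge0. Qed.

Lemma clift1 : clift 1 = 2.
Proof. by rewrite clift_right ?subrr ?branch0; lra. Qed.

Lemma continuous_clift : continuous clift.
Proof.
move=> x; apply: cvgD; last exact: cvg_cst.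
apply: cvgB.
  apply: (@continuous_comp _ _ _ (fun y => Num.min y 2^-1) branch).
    by apply: continuous_min => //; exact: cvg_cst.
  exact: continuous_branch.
apply: (@continuous_comp _ _ _ (fun y => Num.min (1 - y) 2^-1) branch);
  last exact: continuous_branch.
apply: continuous_min; last exact: cvg_cst.
by apply: cvgB; [exact: cvg_cst|exact: cvg_id].
Qed.

(** The Perron-Frobenius operator of the circle map: the right branch is
    conjugate to the left one by [x |-> 1 - x]. *)
Definition transfer f y : R :=
  f (z y) / dbranch (z y) + f (1 - z (1 - y)) / dbranch (z (1 - y)).

Lemma continuous_div_dbranch f : continuous f ->
  continuous (fun y => f (z y) / dbranch (z y)).
Proof.
move=> cf y; apply: (@continuous_comp _ _ _ z (fun x => f x / dbranch x)).
  exact: continuous_ibranch.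
apply: cvgM; first exact: cf.
apply: cvgV; last exact: continuous_dbranch.
by rewrite gt_eqF// dbranch_gt0.
Qed.

Lemma continuous_transfer f : continuous f -> continuous (transfer f).
Proof.
move=> cf x; apply: cvgD; first exact: continuous_div_dbranch.
by have := continuous_onem (continuous_div_dbranch (continuous_onem cf)); exact.
Qed.

(** The substitution [y = branch x] on each half of the circle; periodicity of
    [g] hides the integer by which [clift] differs from the map on the right
    half. *)
Lemma transfer_duality f g : continuous f -> continuous g -> one_periodic g ->
  \int[leb]_(x in `[0, 1]) (g (clift x) * f x) =
  \int[leb]_(x in `[0, 1]) (g x * transfer f x).
Proof.
move=> cf cg pg.
have cgb : continuous (fun x => g (branch x)).
  move=> x; apply: (@continuous_comp _ _ _ branch g); last exact: cg.
  exact: continuous_branch.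
have cgl : continuous (fun x => g (clift x)).
  move=> x; apply: (@continuous_comp _ _ _ clift g); last exact: cg.
  exact: continuous_clift.
have cgf : continuous (fun x => g (branch x) * f x).
  by move=> x; apply: cvgM; [exact: cgb|exact: cf].
have cgf' : continuous (fun x => g (1 - branch x) * f (1 - x)).
  move=> x; apply: cvgM; last exact: continuous_onem.
  apply: (@continuous_comp _ _ _ branch (fun y => g (1 - y))).
    exact: continuous_branch.
  exact: continuous_onem.
have cl : continuous (fun x => g (clift x) * f x).
  by move=> x; apply: cvgM; [exact: cgl|exact: cf].
have c1 := continuous_div_dbranch cgf.
have c2 := continuous_div_dbranch cgf'.
have c3 := continuous_onem c2.
have -> : (fun x => g x * transfer f x) = (fun x =>
    (g (branch (z x)) * f (z x)) / dbranch (z x) +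
    (g (1 - branch (z (1 - x))) * f (1 - z (1 - x))) / dbranch (z (1 - x))).
  by apply/funext => x; rewrite !ibranchK subKr /transfer mulrDr !mulrA.
rewrite RintegralD//; [|exact: continuous_integrable_itv|exact: continuous_integrable_itv].
rewrite (@Rintegral_itv_cat _ _ 0 2^-1)//; last by lra.
congr (_ + _).
  have := Rintegral_ibranch alpha1 cgf (a := 0) (b := 2^-1).
  rewrite branch0 branch_half => ->; last by lra.
  by apply: eq_Rintegral => x; rewrite inE/= in_itv/= => /andP[_ x2]; rewrite clift_left.
rewrite [RHS]Rintegral_itv_onem//; last by rewrite lexx ler01.
rewrite subrr.
transitivity (\int[leb]_(x in `[0, 1]) (g (1 - branch (z x)) * f (1 - z x) / dbranch (z x))).
  have := Rintegral_ibranch alpha1 cgf' (a := 0) (b := 2^-1).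
  rewrite branch0 branch_half => ->; last by lra.
  rewrite Rintegral_itv_onem//; last by lra.
  have -> : 1 - 2^-1 = 2^-1 :> R by lra.
  apply: eq_Rintegral => x; rewrite inE/= in_itv/= => /andP[x2 _].
  by rewrite clift_right// pg subKr.
by apply: eq_Rintegral => x _; rewrite !subKr.
Qed.

Lemma Rintegral_transfer f : continuous f ->
  \int[leb]_(x in `[0, 1]) transfer f x = \int[leb]_(x in `[0, 1]) f x.
Proof.
move=> cf; have := @transfer_duality f (cst 1) cf (@cst_continuous _ _ _) (fun=> erefl).
under eq_Rintegral do rewrite mul1r.
by under [X in _ = X -> _]eq_Rintegral do rewrite mul1r.
Qed.

Section cone.
Variable B : nat.
Hypothesis alphaB : 1 + alpha <= B%:R.

(** For symmetric functions, the monotonicity condition bounds the growth at the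
    neutral point on either side and makes values away from it comparable. *)
Record in_cone f : Prop := InCone {
  cone_continuous : continuous f ;
  cone_onem : forall x, f (1 - x) = f x ;
  cone_ge0 : forall x, 0 <= x <= 1 -> 0 <= f x ;
  cone_mono : forall x y, 0 <= x -> x <= y -> y <= 1 ->
    f x * x ^+ B <= f y * y ^+ B }.

Lemma bernoulli_ineq (r : R) n : -1 <= r -> 1 + n%:R * r <= (1 + r) ^+ n.
Proof.
move=> r1; elim: n => [|n IH]; first by rewrite mul0r addr0 expr0.
rewrite exprS (le_trans _ (ler_wpM2l _ IH))//; last by lra.
have : 0 <= n%:R * r ^+ 2 by rewrite mulr_ge0// sqr_ge0.
by rewrite -natr1 expr2; lra.
Qed.

(** Stated without quotients: [(1 + q) ^ B / (1 + (1 + alpha) q)] increases with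
    [q].  Here the exponent of the cone has to be at least [1 + alpha]. *)
Lemma le_bernoulli_ratio (p q : R) : 0 <= p -> p <= q ->
  (1 + p) ^+ B * (1 + (1 + alpha) * q) <= (1 + q) ^+ B * (1 + (1 + alpha) * p).
Proof.
move=> p0 pq.
have p1 : 0 < 1 + p by lra.
have p1n : 1 + p != 0 by rewrite gt_eqF.
pose r := (q - p) / (1 + p).
have r0 : 0 <= r by rewrite divr_ge0; lra.
have -> : 1 + q = (1 + p) * (1 + r).
  by rewrite mulrDr mulr1 /r [_ * (_ / _)]mulrC divfK//; lra.
have qE : q = p + r * (1 + p) by rewrite /r divfK//; lra.
clearbody r.
rewrite exprMn -mulrA; apply: ler_wpM2l; first by rewrite exprn_ge0// ltW.
have a1 := alpha1.
apply: le_trans (_ : (1 + B%:R * r) * (1 + (1 + alpha) * p) <= _); last first.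
  by apply: ler_wpM2r; [rewrite addr_ge0// mulr_ge0//; lra|apply: bernoulli_ineq; lra].
have h : (1 + alpha) * r * (1 + (1 + alpha) * p) <= B%:R * r * (1 + (1 + alpha) * p).
  apply: ler_wpM2r; first by rewrite addr_ge0// mulr_ge0//; lra.
  by apply: ler_wpM2r.
have h2 : 0 <= alpha * ((1 + alpha) * r * p) by rewrite !mulr_ge0//; lra.
by rewrite qE; nra.
Qed.

(** Write [y = T x].  On either branch, [y ^ B * f x / T' x] is the product of
    [x ^ B * f x] and of [(y / x) ^ B / T' x], and both factors increase with
    [x].  On the left branch, where [y / x = 1 + excess x], the second factor is
    controlled by [le_bernoulli_ratio]; on the right branch [y / x] increases and
    [T'] decreases. *)
Lemma in_cone_transfer f : in_cone f -> in_cone (transfer f).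
Proof.
move=> [cf ef f0 mf]; have a1 := alpha1.
have zi k : 0 <= k -> k <= 1 -> 0 <= z k /\ z k <= 2^-1.
  by move=> k0 k1; apply/andP/ibranch_itv; rewrite k0.
split; first exact: continuous_transfer.
- move=> x; rewrite /transfer addrC subKr.
  by rewrite !ef.
- move=> x /andP[x0 x1].
  have [] := zi x; [lra|lra|move=> z0 z2].
  have [] := zi (1 - x); [lra|lra|move=> w0 w2].
  by apply: addr_ge0; apply: divr_ge0; rewrite ?(ltW (dbranch_gt0 _ _))// f0; lra.
move=> x y x0 xy y1; rewrite /transfer !mulrDl; apply: lerD.
  have zx : 0 <= z x by rewrite ibranch_ge0.
  have zxy : z x <= z y by rewrite le_ibranch.
  have zy : z y <= 1 by have [] := zi y; lra.
  have E w : f (z w) / dbranch (z w) * w ^+ B =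
      f (z w) * z w ^+ B * ((1 + excess (z w)) ^+ B / dbranch (z w)).
    by rewrite -[in w ^+ B](ibranchK alpha1 w) exprMn; ring.
  rewrite !E; apply: ler_pM.
  - by rewrite mulr_ge0 ?exprn_ge0// f0// zx/= (le_trans zxy).
  - by rewrite divr_ge0 ?(ltW (dbranch_gt0 _ _))// exprn_ge0// addr_ge0// excess_ge0.
  - exact: mf.
  rewrite ler_pdivrMr ?dbranch_gt0// mulrAC ler_pdivlMr ?dbranch_gt0//.
  by apply: le_bernoulli_ratio; [exact: excess_ge0|exact: le_excess].
pose v := z (1 - x); pose w := z (1 - y).
have wv : w <= v by rewrite le_ibranch; lra.
have w0 : 0 <= w by rewrite ibranch_ge0; lra.
have v2 : v <= 2^-1 by rewrite ibranch_le_half; lra.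
have E k : k <= 1 -> 0 <= k -> f (1 - z (1 - k)) / dbranch (z (1 - k)) * k ^+ B =
    f (1 - z (1 - k)) * (1 - z (1 - k)) ^+ B *
    ((1 - z (1 - k) * excess (z (1 - k)) / (1 - z (1 - k))) ^+ B / dbranch (z (1 - k))).
  move=> k1 k0.
  have h : z (1 - k) <= 2^-1 by rewrite ibranch_le_half; lra.
  have kE : k = (1 - z (1 - k)) * (1 - z (1 - k) * excess (z (1 - k)) / (1 - z (1 - k))).
    rewrite mulrBr mulr1 mulrC divfK; last by rewrite gt_eqF//; lra.
    by have := ibranchK alpha1 (1 - k); rewrite /branch; lra.
  by rewrite {3}kE exprMn; ring.
have x1 : x <= 1 by lra.
have y0 : 0 <= y by lra.
have pos k : 0 <= k -> k <= 1 -> 0 <= 1 - z (1 - k) * excess (z (1 - k)) / (1 - z (1 - k)).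
  move=> k0 k1; have h : z (1 - k) <= 2^-1 by rewrite ibranch_le_half; lra.
  rewrite subr_ge0 ler_pdivrMr ?mul1r; last by lra.
  by have := ibranchK alpha1 (1 - k); rewrite /branch; lra.
rewrite !E//; apply: ler_pM.
- by rewrite -/v; apply: mulr_ge0; [apply: f0|apply: exprn_ge0]; lra.
- by rewrite divr_ge0 ?(ltW (dbranch_gt0 _ _))// exprn_ge0// pos.
- by apply: mf; rewrite -/v -/w; lra.
apply: ler_pM.
- by rewrite exprn_ge0// pos.
- by rewrite invr_ge0 ltW// dbranch_gt0.
- apply: lerXn2r; rewrite ?nnegrE ?pos// -/v -/w lerB//.
  have v0 : 0 <= v by lra.
  apply: ler_pM; rewrite ?mulr_ge0 ?excess_ge0 ?invr_ge0//; try lra.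
    by apply: ler_pM; rewrite ?excess_ge0//; exact: le_excess.
  by rewrite lef_pV2 ?posrE; lra.
rewrite lef_pV2 ?posrE ?dbranch_gt0// -/v -/w lerD2l ler_wpM2l ?le_excess//.
by lra.
Qed.

End cone.
End transfer.

(** * Supersolutions of the transfer operator *)

Section supersolution.
Context {R : realType}.
Variable alpha : R.
Hypothesis alpha1 : 1 <= alpha.
Notation leb := (@lebesgue_measure R).
Notation excess := (excess alpha).
Notation branch := (branch alpha).
Notation dbranch := (dbranch alpha).
Notation z := (ibranch alpha1).
Notation transfer := (transfer alpha1).
Implicit Types (f g : R -> R) (a b x y t : R).

Lemma continuous_sum (N : nat) (F : nat -> R -> R) :
  (forall k, continuous (F k)) -> continuous (fun x => \sum_(k < N) F k x).
Proof.
move=> cF; elim: N => [|N IH].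
  have -> : (fun x => \sum_(k < 0) F k x) = cst 0.
    by apply/funext => x; rewrite big_ord0.
  by move=> x; exact: cvg_cst.
have -> : (fun x => \sum_(k < N.+1) F k x) =
    (fun x => \sum_(k < N) F k x + F N x).
  by apply/funext => x; rewrite big_ord_recr.
by move=> x; apply: cvgD; [exact: IH|exact: cF].
Qed.

Lemma transfer_sum (N : nat) (F : nat -> R -> R) y :
  transfer (fun x => \sum_(k < N) F k x) y = \sum_(k < N) transfer (F k) y.
Proof. by rewrite /transfer big_split/= !mulr_suml. Qed.

Lemma transferZ c f y : transfer (fun x => c * f x) y = c * transfer f y.
Proof. by rewrite /transfer mulrDr !mulrA. Qed.

Section with_exponent.
Variable B : nat.
Hypothesis alphaB : 1 + alpha <= B%:R.

Notation in_cone := (in_cone B).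

Lemma in_cone_cst1 : in_cone (cst (1 : R)).
Proof.
split => //; first by move=> x; exact: cvg_cst.
move=> x y x0 xy y1; rewrite !mul1r; apply: lerXn2r; rewrite ?nnegrE//.
by rewrite (le_trans x0).
Qed.

Lemma in_cone_sum (N : nat) (F : nat -> R -> R) :
  (forall k, in_cone (F k)) -> in_cone (fun x => \sum_(k < N) F k x).
Proof.
move=> cF; split.
- by apply: continuous_sum => k; have [] := cF k.
- by move=> x; apply: eq_bigr => k _; have [_ ->] := cF k.
- by move=> x x01; apply: sumr_ge0 => k _; have [_ _ /(_ x x01)] := cF k.
- move=> x y x0 xy y1; rewrite !mulr_suml; apply: ler_sum => k _.
  by have [_ _ _] := cF k; exact.
Qed.

Lemma in_coneZ c f : 0 <= c -> in_cone f -> in_cone (fun x => c * f x).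
Proof.
move=> c0 [cf ef f0 mf]; split.
- by move=> x; apply: cvgM; [exact: cvg_cst|exact: cf].
- by move=> x; rewrite ef.
- by move=> x /f0; exact: mulr_ge0.
- by move=> x y x0 xy y1; rewrite -!mulrA ler_wpM2l// mf.
Qed.

(** By symmetry one may take [x <= 1/2], where monotonicity compares [f x] with
    [f (1/2)]. *)
Lemma cone_le_half f a x : in_cone f -> 0 < a -> a <= x <= 1 - a ->
  f x <= f 2^-1 / a ^+ B.
Proof.
move=> [cf ef f0 mf] a0 /andP[].
wlog : x / x <= 2^-1.
  move=> h ax xa; have [x2|x2] := leP x 2^-1; first exact: h.
  by rewrite -ef; apply: h; lra.
move=> x2 ax xa; rewrite ler_pdivlMr ?exprn_gt0//.
apply: (@le_trans _ _ (f x * x ^+ B)).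
  apply: ler_wpM2l; first by apply: f0; lra.
  by apply: lerXn2r; rewrite ?nnegrE; lra.
apply: (@le_trans _ _ (f 2^-1 * 2^-1 ^+ B)); first by apply: mf; lra.
rewrite -[leRHS]mulr1; apply: ler_wpM2l; first by apply: f0; lra.
by apply: exprn_ile1; lra.
Qed.

Lemma cone_half_le f x : in_cone f -> 2^-1 <= x <= 1 ->
  f 2^-1 * 2^-1 ^+ B <= f x.
Proof.
move=> [cf ef f0 mf] /andP[x2 x1].
apply: (@le_trans _ _ (f x * x ^+ B)); first by apply: mf; lra.
rewrite -[leRHS]mulr1; apply: ler_wpM2l; first by apply: f0; lra.
by apply: exprn_ile1; lra.
Qed.

Lemma cone_half_le_int f : in_cone f ->
  f 2^-1 <= 2 ^+ B.+1 * \int[leb]_(x in `[0, 1]) f x.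
Proof.
move=> cf; have [cnf ef f0 mf] := cf.
have h : f 2^-1 * 2^-1 ^+ B / 2 <= \int[leb]_(x in `[0, 1]) f x.
  rewrite (@Rintegral_itv_cat _ _ 0 2^-1)//; last by lra.
  rewrite ler_wpDl//.
    apply: Rintegral_ge0 => x/=; rewrite in_itv/= => x01; apply: f0; lra.
  apply: (@le_trans _ _ (\int[leb]_(x in `[2^-1, 1]) (f 2^-1 * 2^-1 ^+ B))).
    rewrite Rintegral_itv_cst; last by lra.
    by have -> : 1 - 2^-1 = 2^-1 :> R by lra.
  apply: le_Rintegral_itv => //; first by move=> x; exact: cvg_cst.
  by move=> x; exact: cone_half_le.
rewrite -ler_pdivrMl ?exprn_gt0// exprS invfM mulrC mulrA mulrAC.
by rewrite -exprVn.
Qed.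

Let f_ n : R -> R := iter n transfer (cst 1).

Lemma in_cone_iter n : in_cone (f_ n).
Proof. by elim: n => [|n IH]; [exact: in_cone_cst1|exact: in_cone_transfer]. Qed.

Lemma Rintegral_iter n : \int[leb]_(x in `[0, 1]) f_ n x = 1.
Proof.
elim: n => [|n IH].
  by rewrite /f_/= Rintegral_itv_cst ?ler01// subr0 mulr1.
by rewrite -[RHS]IH; apply: Rintegral_transfer; have [] := in_cone_iter n.
Qed.

(** At a point of [[0, 1/2]], which suffices by symmetry, the left branch
    contributes at most the previous supremum, and the right branch draws from a
    region away from the neutral point, where the cone and the unit mass
    give a uniform bound: the supremum grows by a bounded amount at each step. *)
Lemma iter_transfer_le n x : 0 <= x <= 1 ->
  f_ n x <= 1 + n%:R * (2 ^+ B.+1 / 4^-1 ^+ B).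
Proof.
set C := _ / _.
elim: n x => [|n IH] x; first by rewrite mul0r addr0 /f_.
wlog : x / x <= 2^-1.
  move=> h x01; have [x2|x2] := leP x 2^-1; first exact: h.
  have [_ <- _ _] := in_cone_iter n.+1.
  by apply: h; lra.
move=> x2 /andP[x0 x1]; rewrite -natr1.
have [cf ef f0 mf] := in_cone_iter n.
have zx : 0 <= z x <= 2^-1 by apply: ibranch_itv; lra.
have zy : 0 <= z (1 - x) <= 2^-1 by apply: ibranch_itv; lra.
have z4 : 4^-1 <= z (1 - x).
  rewrite -(le_branch alpha1) ibranchK /branch.
  have e4 : excess 4^-1 <= 2 * 4^-1 by apply: excess_le => //; lra.
  lra.
have e1 : f_ n (z x) / dbranch (z x) <= f_ n (z x).
  rewrite ler_pdivrMr ?dbranch_gt0// ler_peMr ?dbranch_ge1//.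
  by apply: f0; lra.
have e2 : f_ n (1 - z (1 - x)) / dbranch (z (1 - x)) <= C.
  rewrite ler_pdivrMr ?dbranch_gt0//; apply: (@le_trans _ _ C).
    apply: (@le_trans _ _ (f_ n 2^-1 / 4^-1 ^+ B)).
      by apply: cone_le_half; [exact: in_cone_iter|lra|lra].
    rewrite ler_wpM2r ?invr_ge0 ?exprn_ge0 ?invr_ge0//.
    by have := cone_half_le_int (in_cone_iter n); rewrite Rintegral_iter mulr1.
  rewrite ler_peMr ?dbranch_ge1// divr_ge0 ?exprn_ge0//; lra.
have e3 : f_ n (z x) <= 1 + n%:R * C by apply: IH; lra.
apply: (@le_trans _ _ (f_ n (z x) + C)); last by lra.
exact: lerD.
Qed.

Let a_ k : R := iter k z 1.

(** Since [alpha >= 1], the branch satisfies [branch w <= w + 2 * w ^ 2] on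
    [[0, 1/2]], so that the inverses of the points of a backward orbit grow by at
    most [2] at each step. *)
Lemma backward_ge k : (2 * k%:R + 1)^-1 <= a_ k <= 1.
Proof.
elim: k => [|k /andP[IH1 IH2]]; first by rewrite mulr0 add0r invr1 lexx.
have k0 : 0 < 2 * k%:R + 1 :> R by rewrite ltr_wpDl// mulr_ge0.
have ak0 : 0 < a_ k by rewrite (lt_le_trans _ IH1)// invr_gt0.
rewrite /a_ iterS -/(a_ k).
have : 0 <= z (a_ k) <= 2^-1 by apply: ibranch_itv; lra.
move=> /andP[z0 z2]; apply/andP; split; last by lra.
have zE := ibranchK alpha1 (a_ k).
have ez : excess (z (a_ k)) <= 2 * z (a_ k) by apply: excess_le => //; rewrite z0.
set w := z (a_ k) in z0 z2 zE ez *.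
have ew := excess_ge0 alpha w.
have w0 : 0 < w.
  rewrite lt_neqAle z0 andbT; apply/eqP => w0.
  by move: zE ak0; rewrite -w0 branch0 => <-; rewrite ltxx.
have h : 1 <= (2 * k%:R + 1) * a_ k by rewrite -ler_pdivrMl// mulr1.
rewrite -[leLHS]mul1r -[k.+1%:R]natr1 ler_pdivrMr; last by lra.
suff : a_ k * 1 <= a_ k * (w * (2 * (k%:R + 1) + 1)) by rewrite ler_pM2l.
have aw : a_ k = w * (1 + excess w) by rewrite -zE.
have hw : w * 1 <= w * ((2 * k%:R + 1) * a_ k) by rewrite ler_pM2l.
have we : w * excess w <= w * (2 * w) by rewrite ler_pM2l.
have ww : w * w <= w * a_ k.
  by rewrite ler_pM2l// aw mulrDr mulr1 lerDl mulr_ge0.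
lra.
Qed.

(** The preimage of [[0, a_k]] consists of [[0, a_k.+1]] and of an interval at
    [1/2] on which [f] is at least a fixed multiple of [f (1/2)]; iterating,
    these contributions to the mass near the neutral point add up. *)
Lemma Rintegral_escape f s K : in_cone f -> 0 <= s ->
  (forall x, 0 <= x <= 1 -> s * transfer f x <= f x) ->
  f 2^-1 * 2^-1 ^+ B / (2 + alpha) * (\sum_(k < K) s ^+ k.+1 * a_ k)
    <= \int[leb]_(x in `[0, 1]) f x.
Proof.
move=> cf s0 hs; have [cnf ef f0 mf] := cf.
set c := _ / (2 + alpha).
have a1 := alpha1.
have c0 : 0 <= c by rewrite divr_ge0// ?mulr_ge0 ?exprn_ge0 ?f0//; lra.
suff : c * (\sum_(k < K) s ^+ k.+1 * a_ k) +
    s ^+ K * \int[leb]_(x in `[0, a_ K]) f x <= \int[leb]_(x in `[0, 1]) f x.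
  apply: le_trans; rewrite lerDl mulr_ge0 ?exprn_ge0//.
  apply: Rintegral_ge0 => x/=; rewrite in_itv/= => /andP[x0 xa].
  by apply: f0; have /andP[] := backward_ge K; lra.
elim: K => [|K IH]; first by rewrite big_ord0 mulr0 add0r expr0 mul1r.
apply: le_trans IH; rewrite big_ord_recr/= mulrDr -addrA lerD2l.
have /andP[aK0 aK1] := backward_ge K.
have a0 : 0 <= a_ K by rewrite (le_trans _ aK0)// invr_ge0 addr_ge0// mulr_ge0.
rewrite exprSr -mulrA mulrCA -mulrA -mulrDr ler_wpM2l ?exprn_ge0//.
rewrite mulrCA -mulrDr.
have ct := @continuous_transfer _ _ alpha1 _ cnf.
apply: (@le_trans _ _ (\int[leb]_(x in `[0, a_ K]) (s * transfer f x))); last first.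
  apply: le_Rintegral_itv => //; first by move=> x; apply: cvgM; [exact: cvg_cst|exact: ct].
  by move=> x /andP[x0 xa]; apply: hs; lra.
rewrite RintegralZl//; last exact: continuous_integrable_itv.
rewrite ler_wpM2l//.
have c1 := @continuous_div_dbranch _ _ alpha1 _ cnf.
have c2 := continuous_onem (@continuous_div_dbranch _ _ alpha1 _ (continuous_onem cnf)).
rewrite RintegralD//; [|exact: continuous_integrable_itv|exact: continuous_integrable_itv].
have := Rintegral_ibranch alpha1 cnf (a := 0) (b := a_ K.+1).
rewrite {2}/a_ iterS ibranchK branch0 => ->; last first.
  by rewrite /a_ iterS ibranch_ge0.
rewrite addrC lerD2l.
rewrite -[leLHS](_ : \int[leb]_(x in `[0, a_ K]) c = _); last first.
  by rewrite Rintegral_itv_cst// subr0 mulrC.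
apply: le_Rintegral_itv => //; first by move=> x; exact: cvg_cst.
move=> x /andP[x0 xa].
have zx : 0 <= z (1 - x) <= 2^-1 by apply: ibranch_itv; lra.
apply: ler_pM.
- by rewrite mulr_ge0 ?exprn_ge0// f0//; lra.
- by rewrite invr_ge0; lra.
- by apply: cone_half_le => //; lra.
rewrite lef_pV2 ?posrE ?dbranch_gt0//; last by lra.
rewrite /dbranch.
have : excess (z (1 - x)) <= excess 2^-1 by apply: le_excess => //; lra.
rewrite excess_half => e1.
have : (1 + alpha) * excess (z (1 - x)) <= (1 + alpha) * 1 by apply: ler_wpM2l; lra.
lra.
Qed.


Lemma sum_transfer s N x :
  s * transfer (fun y => \sum_(k < N) s ^+ k * f_ k y) x =
  \sum_(k < N) s ^+ k * f_ k x - 1 + s ^+ N * f_ N x.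
Proof.
rewrite (transfer_sum N (fun k y => s ^+ k * f_ k y)).
elim: N => [|N IH]; first by rewrite !big_ord0 expr0 mulr0 /f_/=; lra.
rewrite !big_ord_recr/= mulrDr IH transferZ exprS.
have -> : transfer (f_ N) x = f_ N.+1 x by [].
lra.
Qed.

Lemma in_cone_sum_iter s N : 0 <= s ->
  in_cone (fun y => \sum_(k < N) s ^+ k * f_ k y).
Proof.
move=> s0; apply: (@in_cone_sum N (fun k y => s ^+ k * f_ k y)) => k.
by apply: in_coneZ; [exact: exprn_ge0|exact: in_cone_iter].
Qed.

Lemma Rintegral_sum_iter s N : 0 <= s < 1 ->
  \int[leb]_(x in `[0, 1]) (\sum_(k < N) s ^+ k * f_ k x) <= (1 - s)^-1.
Proof.
move=> /andP[s0 s1].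
have -> : \int[leb]_(x in `[0, 1]) (\sum_(k < N) s ^+ k * f_ k x) = \sum_(k < N) s ^+ k.
  elim: N => [|N IH].
    rewrite big_ord0 -[RHS](@mul0r _ (1 - 0 : R)) -Rintegral_itv_cst//.
    by apply: eq_Rintegral => x _; rewrite big_ord0.
  under eq_Rintegral do rewrite big_ord_recr/=.
  have [cN _ _ _] := in_cone_iter N.
  have [cS _ _ _] := in_cone_sum_iter N s0.
  rewrite RintegralD//; last 2 first.
  - exact: continuous_integrable_itv.
  - by apply: continuous_integrable_itv => x; apply: cvgM; [exact: cvg_cst|exact: cN].
  rewrite IH RintegralZl//; last exact: continuous_integrable_itv.
  by rewrite Rintegral_iter mulr1 big_ord_recr.
rewrite -[leRHS]mul1r ler_pdivlMr; last by lra.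
have := subrX1 s N; have := exprn_ge0 N s0; lra.
Qed.

(** Splitting [s = r ^ 2]: by Bernoulli's inequality, [r ^ N * (1 + N * C)] stays
    bounded while the other factor [r ^ N] tends to [0]. *)
Lemma geometric_beats_linear (s C : R) : 0 < s < 1 -> 0 <= C ->
  exists2 N, (0 < N)%N & s ^+ N * (1 + N%:R * C) <= 2^-1.
Proof.
move=> /andP[s0 s1] C0.
pose r := Num.sqrt s.
have r0 : 0 < r by rewrite sqrtr_gt0.
have r2 : r ^+ 2 = s by rewrite sqr_sqrtr// ltW.
have r1 : r < 1 by rewrite -(ltr_pXn2r (n := 2))// ?nnegrE ?ltW// r2 expr1n.
pose h := r^-1 - 1.
have h0 : 0 < h by rewrite subr_gt0 invf_gt1.
have rh : r = (1 + h)^-1 by rewrite /h addrC subrK invrK.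
pose M := 1 + C / h.
have M0 : 0 < M by rewrite ltr_wpDr// divr_ge0// ltW.
have bound n : r ^+ n * (1 + n%:R * C) <= M.
  rewrite rh exprVn mulrC ler_pdivrMr; last by rewrite exprn_gt0//; lra.
  apply: (@le_trans _ _ (M * (1 + n%:R * h))); last first.
    by rewrite ler_pM2l//; apply: bernoulli_ineq; lra.
  have : 0 <= C / h by rewrite divr_ge0// ltW.
  have : 0 <= n%:R * h by rewrite mulr_ge0// ltW.
  have : C / h * (n%:R * h) = n%:R * C by rewrite mulrCA divfK// gt_eqF.
  by rewrite /M; lra.
have : \forall n \near \oo, `|r ^+ n| < (2 * M)^-1.
  apply: cvgr0_norm_lt; last by rewrite invr_gt0 mulr_gt0.
  by apply: cvg_expr; rewrite gtr0_norm.
case=> N _ hN; exists N.+1 => //.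
have := hN N.+1 (leqnSn N); rewrite ger0_norm ?exprn_ge0 ?(ltW r0)// => rN.
rewrite -r2 -exprM mulnC exprM expr2 -mulrA.
apply: (@le_trans _ _ ((2 * M)^-1 * M)).
  have rN0 : 0 <= r ^+ N.+1 by rewrite exprn_ge0// ltW.
  apply: ler_pM => //.
    by rewrite mulr_ge0// addr_ge0// mulr_ge0.
  exact: ltW.
by rewrite invfM mulfVK// gt_eqF.
Qed.

Lemma harmonic_unbounded (Q : R) :
  exists K, Q <= \sum_(k < K) (k.+1%:R)^-1.
Proof.
apply: contrapT => /forallNP h; apply: (@dvg_harmonic R).
apply: nondecreasing_is_cvgn.
  by apply: nondecreasing_series => n _ _; exact: harmonic_ge0.
exists Q => _ [n _ <-]; rewrite /series/= big_mkord.
by have /negP := h n; rewrite -ltNge => /ltW.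
Qed.

(** The function [u] is the truncated resolvent [\sum_(k < N) s ^+ k * f_ k].
    Its integral is at most [1 / (1 - s)], but most of its mass sits near the
    neutral point by [Rintegral_escape], so that [(1 - s) * u] is small away
    from it.  The truncation rank [N] is chosen last, such that the remainder
    [s ^+ N * f_ N] of the telescoping sum is at most [1/2]. *)
Lemma supersolution_with_exponent (d eta : R) : 0 < d -> 0 < eta ->
  exists s (u : R -> R),
    [/\ 2^-1 <= s < 1, in_cone u,
        forall x, 0 <= x <= 1 -> 1 <= u x,
        forall x, 0 <= x <= 1 -> s * transfer u x <= u x - 2^-1 &
        forall x, d <= x <= 1 - d -> (1 - s) * u x <= eta].
Proof.
move=> d0 eta0; have a1 := alpha1.
pose c : R := 2^-1 ^+ B / (2 + alpha).
have c0 : 0 < c by rewrite divr_gt0 ?exprn_gt0 ?invr_gt0//; lra.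
have [K hK] := harmonic_unbounded (4 / (c * d ^+ B * eta)).
have cde : 0 < c * d ^+ B * eta.
  by apply: mulr_gt0 => //; apply: mulr_gt0 => //; exact: exprn_gt0.
set H := \sum_(_ < _) _ in hK.
have H0 : 0 < H by apply: lt_le_trans hK; rewrite divr_gt0.
(* chosen such that the first [K] powers of [s] stay above [1/2] *)
pose s : R := 1 - (2 * (K%:R + 1))^-1.
have K1 : 0 < 2 * (K%:R + 1) :> R by rewrite mulr_gt0// ltr_wpDl.
have s1 : s < 1 by rewrite ltrBlDr ltrDl invr_gt0.
have s2 : 2^-1 <= s.
  rewrite /s invfM; have : (K%:R + 1)^-1 <= 1 :> R by rewrite invf_le1 ?lerDr// ltr_wpDl.
  lra.
have sK : 2^-1 <= s ^+ K.
  have e : K%:R * (2 * (K%:R + 1))^-1 <= 2^-1 :> R.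
    by rewrite ler_pdivrMr// mulrA mulVf// mul1r lerDl.
  apply: (le_trans _ (@bernoulli_ineq _ (- (2 * (K%:R + 1))^-1) K _)).
    by rewrite mulrN; lra.
  by move: s2; rewrite /s; lra.
have s0 : 0 < s by lra.
pose C : R := 2 ^+ B.+1 / 4^-1 ^+ B.
have C0 : 0 <= C by rewrite divr_ge0 ?exprn_ge0// invr_ge0.
have [|N N0 hN] := @geometric_beats_linear s C _ C0; first by rewrite s0.
pose u x := \sum_(k < N) s ^+ k * f_ k x.
have cu : in_cone u by apply: in_cone_sum_iter; lra.
have su x : 0 <= x <= 1 -> s * transfer u x <= u x - 2^-1.
  move=> x01; rewrite sum_transfer -/(u x).
  have : s ^+ N * f_ N x <= s ^+ N * (1 + N%:R * C).
    by apply: ler_wpM2l; [apply: exprn_ge0; lra|exact: iter_transfer_le].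
  lra.
exists s, u; split=> //; first by rewrite s2.
  move=> x x01; rewrite /u; case: (N) N0 => // n _; rewrite big_ord_recl expr0 mul1r.
  rewrite lerDl; apply: sumr_ge0 => i _; apply: mulr_ge0; first by apply: exprn_ge0; lra.
  by have [_ _ f0 _] := in_cone_iter (lift ord0 i); exact: f0.
have cH0 : 0 < c * H by exact: mulr_gt0.
have u2 : (1 - s) * u 2^-1 <= 4 / (c * H).
  have hu x : 0 <= x <= 1 -> s * transfer u x <= u x by move=> /su; lra.
  have := le_trans (Rintegral_escape K cu (ltW s0) hu) (Rintegral_sum_iter N _).
  rewrite (ltW s0) s1 => /(_ isT).
  set S := \sum_(k < K) _ => hS.
  have u0 : 0 <= u 2^-1 by have [_ _ f0 _] := cu; apply: f0; lra.
  have SH : H / 4 <= S.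
    rewrite mulr_suml; apply: ler_sum => k _.
    have /andP[ak _] := backward_ge k.
    have e1 : 2^-1 <= s ^+ k.+1.
      by apply: le_trans sK _; apply: ler_wiXn2l; [lra|lra|exact: ltn_ord].
    have e2 : (k.+1%:R)^-1 / 2 <= a_ k.
      apply: le_trans ak; rewrite -invfM lef_pV2 ?posrE.
      - by rewrite -natr1 mulrC mulrDr; lra.
      - by rewrite mulr_gt0.
      - by rewrite ltr_wpDl// mulr_ge0.
    have e0 : 0 <= (k.+1%:R)^-1 :> R by rewrite invr_ge0.
    have E (q : R) : q / 4 = 2^-1 * (q / 2) by lra.
    rewrite E.
    by apply: ler_pM => //; rewrite ?divr_ge0// invr_ge0.
  rewrite ler_pdivlMr//.
  have : u 2^-1 * c * (H / 4) <= (1 - s)^-1.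
    apply: le_trans hS; rewrite -[X in _ <= X * _]mulrA; apply: ler_wpM2l => //.
    by rewrite mulr_ge0// ltW.
  rewrite -[X in _ <= X]mul1r ler_pdivlMr; last by lra.
  lra.
move=> x xd.
have ux := cone_le_half cu d0 xd.
have s1' : 0 <= 1 - s by lra.
apply: le_trans (ler_wpM2l s1' ux) _.
rewrite mulrA ler_pdivrMr ?exprn_gt0//; apply: le_trans u2 _.
rewrite ler_pdivrMr//.
by move: hK; rewrite ler_pdivrMr//; lra.
Qed.

End with_exponent.

Theorem supersolution (d eta : R) : 0 < d -> 0 < eta ->
  exists s (u : R -> R),
    [/\ 2^-1 <= s < 1, continuous u /\ u 0 = u 1,
        forall x, 0 <= x <= 1 -> 1 <= u x,
        forall x, 0 <= x <= 1 -> s * transfer u x <= u x - 2^-1 &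
        forall x, d <= x <= 1 - d -> (1 - s) * u x <= eta].
Proof.
move=> d0 eta0.
pose B := (Num.trunc (1 + alpha)).+1.
have alphaB : 1 + alpha <= B%:R by apply: ltW; exact: truncnS_gt.
have [s [u [s1 [cu eu _ _] u1 su ud]]] := supersolution_with_exponent alphaB d0 eta0.
by exists s, u; split => //; split => //; rewrite -eu subr0.
Qed.

End supersolution.

(** * Integration against probability measures *)

Section probability_integral.
Context {R : realType} {d d' : measure_display}.
Context {T : measurableType d} {T' : measurableType d'}.
Variables (P : probability T R) (P' : probability T' R).

Lemma bounded_integrable (f : T -> R) M : measurable_fun setT f ->
  (forall x, `|f x| <= M) -> P.-integrable setT (EFin \o f).
Proof.
move=> mf fM; apply: measurable_bounded_integrable => //.
  by rewrite ltey_eq fin_num_measure.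
exists M; split; first exact: num_real.
by move=> y My x _ /=; rewrite (le_trans (fM x))// ltW.
Qed.

Lemma Rintegral_prob_cst c : \int[P]_x c = c :> R.
Proof.
rewrite Rintegral_cst// -[RHS]mulr1; congr (_ * _).
exact: (congr1 fine (probability_setT P)).
Qed.

Lemma Rintegral_le_cst_ae (f : T -> R) M c (N : set T) :
  measurable_fun setT f -> (forall x, 0 <= f x <= M) ->
  measurable N -> P N = 0%E -> 0 <= c -> (forall x, ~ N x -> f x <= c) ->
  \int[P]_x f x <= c.
Proof.
move=> mf fM mN N0 c0 fc.
have if_ : P.-integrable setT (EFin \o f).
  apply: (@bounded_integrable f M) => // x.
  by have /andP[f0 fM'] := fM x; rewrite ger0_norm.
rewrite -lee_fin fineK; last exact: integrable_fin_num.
rewrite -(Rintegral_prob_cst c) fineK; last first.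
  apply: integrable_fin_num => //.
  exact: (@bounded_integrable (cst c) `|c|).
apply: ae_ge0_le_integral => //.
- by move=> x _; rewrite lee_fin; have /andP[] := fM x.
- exact/measurable_EFinP.
- by exists N; split => // x /= /not_implyP[_ h]; apply: contrapT => /fc; rewrite -lee_fin.
Qed.

End probability_integral.

Section swap.
Context {R : realType} {d d' : measure_display}.
Context {T : measurableType d} {T' : measurableType d'}.
Variables (P : probability T R) (P' : probability T' R).

Lemma Rintegral_swap (F : T * T' -> R) M : measurable_fun setT F ->
  (forall p, `|F p| <= M) ->
  \int[P]_x \int[P']_y F (x, y) = \int[P']_y \int[P]_x F (x, y).
Proof.
move=> mF FM.
have iF : (P \x P')%E.-integrable setT (EFin \o F).
  exact: (@bounded_integrable _ _ _ (P \x P')%E _ M).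
have e1 x : (\int[P']_y (F (x, y))%:E)%E = (fine (\int[P']_y (F (x, y))%:E))%:E.
  rewrite fineK//; apply: integrable_fin_num => //.
  apply: (@bounded_integrable _ _ _ P' (fun y => F (x, y)) M) => //.
  exact: measurableT_comp.
have e2 y : (\int[P]_x (F (x, y))%:E)%E = (fine (\int[P]_x (F (x, y))%:E))%:E.
  rewrite fineK//; apply: integrable_fin_num => //.
  apply: (@bounded_integrable _ _ _ P (fun x => F (x, y)) M) => //.
  exact: measurableT_comp.
rewrite /Rintegral; congr fine.
transitivity (\int[P]_x \int[P']_y (EFin \o F) (x, y))%E.
  by apply: eq_integral => x _; rewrite -e1.
rewrite (Fubini iF).
by apply: eq_integral => y _; rewrite -e2.
Qed.

End swap.

Section markov_itv.
Context {R : realType}.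
Notation leb := (@lebesgue_measure R).

Lemma measurable_norm_gt (e : R) : measurable ([set t | e < `|t|] : set R).
Proof.
have -> : [set t | e < `|t|] = setT `&` (@Num.norm R R) @^-1` `]e, +oo[.
  by rewrite setTI; apply/seteqP; split => t /=; rewrite in_itv/= andbT.
exact: (continuous_measurable_fun (@norm_continuous _ R)).
Qed.

Lemma lebesgue_markov (f : R -> R) (a b c : R) : continuous f -> (forall x, 0 <= f x) ->
  0 < c ->
  (leb (`[a, b] `&` [set t | (c <= f t)%R]) <= (c^-1 * \int[leb]_(x in `[a, b]) f x)%R%:E)%E.
Proof.
move=> cf f0 c0.
have mE : measurable ([set t | c <= f t] : set R).
  have : measurable (setT `&` (fun x => f x) @^-1` `[c, +oo[).
    by apply: continuous_measurable_fun.
  by rewrite setTI; congr measurable; apply/seteqP; split => x/=; rewrite in_itv/= andbT.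
have mI : measurable (`[a, b]%classic : set R) by exact: measurable_itv.
have mEI : measurable (`[a, b] `&` [set t | c <= f t]) by exact: measurableI.
have mf D : measurable_fun D (EFin \o f).
  by apply/measurable_EFinP; apply: measurable_funTS; exact: continuous_measurable_fun.
have If : (\int[leb]_(x in `[a, b]) (f x)%:E = (\int[leb]_(x in `[a, b]) f x)%:E)%E.
  by rewrite fineK//; apply: integrable_fin_num => //; exact: continuous_integrable_itv.
rewrite EFinM lee_pdivlMl// -If.
apply: (@le_trans _ _ (\int[leb]_(x in `[a, b] `&` [set t | (c <= f t)%R]) (f x)%:E)%E).
  rewrite -integral_cst//; apply: ge0_le_integral => //=.
  - by move=> x _; rewrite lee_fin ltW.
  - exact: mf.
  - by move=> x [_ /=]; rewrite lee_fin.
apply: ge0_subset_integral => //; first exact: mf.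
by move=> x _; rewrite lee_fin.
Qed.

End markov_itv.

Section absolute_continuity.
Context {d : measure_display} {T : measurableType d} {R : realType}.

(** By the Borel-Cantelli lemma the upper limit of the sets is [m]-null, hence
    [P]-null, whereas a uniform lower bound on their probabilities would pass to
    the upper limit. *)
Lemma dominated_geometric (P : probability T R) (m : {measure set T -> \bar R})
    (F : (set T)^nat) (A rho b : R) :
  P `<< m -> (forall n, measurable (F n)) -> 0 <= rho < 1 -> 0 <= A ->
  (forall n, (m (F n) <= (A * rho ^+ n)%:E)%E) -> 0 < b ->
  exists n, (P (F n) < b%:E)%E.
Proof.
move=> Pm mF /andP[rho0 rho1] A0 hF b0; apply: contrapT => /forallNP hb.
have mS : measurable (lim_sup_set F).
  by apply: bigcap_measurable => // n _; exact: bigcup_measurable.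
have mS0 : m (lim_sup_set F) = 0%E.
  apply: lim_sup_set_cvg0 => //.
  apply: (@le_lt_trans _ _ (A / (1 - rho))%:E); last exact: ltry.
  apply: lime_le; first by apply: is_cvg_nneseries => n _ _; exact: measure_ge0.
  apply: nearW => n.
  apply: (@le_trans _ _ (\sum_(0 <= k < n) (A * rho ^+ k)%:E)%E).
    by apply: lee_sum => k _; exact: hF.
  rewrite sumEFin lee_fin -mulr_sumr ler_wpM2l// big_mkord.
  rewrite -[leRHS]mul1r ler_pdivlMr; last by lra.
  by have := subrX1 rho n; have := exprn_ge0 n rho0; lra.
have PS0 : P (lim_sup_set F) = 0%E.
  by have /null_content_dominatesP := Pm; exact.
have cS := @lim_sup_set_cvg _ _ _ P F mF.
have : (b%:E <= P (lim_sup_set F))%E.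
  rewrite -(cvg_lim _ (cS _))//; last first.
    by rewrite (le_lt_trans (probability_le1 _ _)) ?ltry//; exact: bigcup_measurable.
  apply: lime_ge.
    apply/cvg_ex; exists (P (lim_sup_set F)); apply: cS.
    by rewrite (le_lt_trans (probability_le1 _ _)) ?ltry//; exact: bigcup_measurable.
  apply: nearW => n; apply: (@le_trans _ _ (P (F n))).
    by rewrite leNgt; apply/negP; exact: hb.
  apply: le_measure; rewrite ?inE//; first exact: bigcup_measurable.
  by move=> x Fx; exists n => /=.
by rewrite PS0 lee_fin leNgt b0.
Qed.

End absolute_continuity.

(** * Averaging over the noise *)

Section noise.
Context {R : realType}.
Variables (alpha : R) (theta : probability (measurableTypeR R) R).
Hypothesis alpha1 : 1 <= alpha.
Notation leb := (@lebesgue_measure R).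
Notation clift := (clift alpha).
Notation transfer := (transfer alpha1).
Implicit Types (f g : R -> R) (a b x y t : R).

(** The Markov operator of the random map; reducing [x] to the unit interval
    makes it act on periodic functions. *)
Definition noise_avg g x : R := \int[theta]_t g (clift (fpart x) + t).

Lemma continuous_clift_fpart g t : continuous g -> one_periodic g ->
  continuous (fun x => g (clift (fpart x) + t)).
Proof.
move=> cg pg; apply: (@continuous_fpart _ (fun x => g (clift x + t))).
  move=> x; apply: (@continuous_comp _ _ _ clift (fun y => g (y + t))).
    exact: continuous_clift.
  exact: continuous_translate.
by rewrite clift0 clift1 add0r -(periodicDn pg 2 t) addrC.
Qed.

Lemma noise_integrable g c : continuous g -> one_periodic g ->
  theta.-integrable setT (EFin \o (fun t => g (c + t))).
Proof.
move=> cg pg; have [M M0 gM] := periodic_bounded cg pg.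
apply: (@bounded_integrable _ _ _ theta _ M) => // x.
have -> : (fun t => g (c + t)) = (fun t => g (t + c)).
  by apply/funext => t; rewrite addrC.
exact: (continuous_measurable_fun (@continuous_translate _ g c cg)).
Qed.

Lemma periodic_noise_avg g : one_periodic (noise_avg g).
Proof. by move=> x; rewrite /noise_avg fpartD1. Qed.

Lemma continuous_noise_avg g : continuous g -> one_periodic g ->
  continuous (noise_avg g).
Proof.
move=> cg pg x; have [M M0 gM] := periodic_bounded cg pg.
have := @continuity_under_integral R _ _ theta (fun x t => g (clift (fpart x) + t))
  setT measurableT (x - 1) (x + 1) _ _ (cst M) _ _.
apply.
- by move=> y _; exact: noise_integrable.
- by apply: aeW => t _ y _; exact: continuous_clift_fpart.
- apply: (@bounded_integrable _ _ _ theta _ M) => //.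
  by move=> y; rewrite /= ger0_norm// ltW.
- by move=> y _; apply: aeW => t _.
- by rewrite inE/= in_itv/=; lra.
Qed.

Lemma le_noise_avg f g : continuous f -> one_periodic f ->
  continuous g -> one_periodic g -> (forall x, f x <= g x) ->
  forall x, noise_avg f x <= noise_avg g x.
Proof.
move=> cf pf cg pg fg x; apply: le_Rintegral => //; exact: noise_integrable.
Qed.

Lemma noise_avg_cst c x : noise_avg (cst c) x = c.
Proof. exact: Rintegral_prob_cst. Qed.

(** Jensen's inequality, from the tangent to the exponential at the mean. *)
Lemma jensen_noise_avg f x : continuous f -> one_periodic f ->
  expR (noise_avg f x) <= noise_avg (expR \o f) x.
Proof.
move=> cf pf; set m := noise_avg f x.
have ce : continuous (expR \o f).
  by move=> y; apply: continuous_comp; [exact: cf|exact: continuous_expR].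
have pe : one_periodic (expR \o f) by move=> y /=; rewrite pf.
have -> : expR m = \int[theta]_t (expR m * (1 - m) + expR m * f (clift (fpart x) + t)).
  have if_ := noise_integrable (clift (fpart x)) cf pf.
  rewrite RintegralD//; last 2 first.
  - apply: (@bounded_integrable _ _ _ theta _ `|expR m * (1 - m)|) => //.
  - exact: (integrableZl _ (expR m) if_).
  rewrite Rintegral_prob_cst RintegralZl// -/(noise_avg f x) -/m.
  by rewrite -mulrDr subrK mulr1.
apply: le_Rintegral => //.
- have cl : continuous (fun y => expR m * (1 - m) + expR m * f y).
    by move=> y; apply: cvgD; [exact: cvg_cst|apply: cvgM; [exact: cvg_cst|exact: cf]].
  have pl : one_periodic (fun y => expR m * (1 - m) + expR m * f y) by move=> y; rewrite pf.
  exact: (noise_integrable (clift (fpart x)) cl pl).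
- exact: (noise_integrable (clift (fpart x)) ce pe).
move=> t _ /=; set v := f _.
have -> : expR v = expR m * expR (v - m) by rewrite -expRD addrC subrK.
rewrite -mulrDr ler_wpM2l ?expR_ge0//.
by have := expR_ge1Dx (v - m); lra.
Qed.

End noise.

(** * The entropy inequality *)

Section entropy.
Context {R : realType} {d : measure_display} {Omega : measurableType d}.
Variables (alpha eps : R) (theta : probability (measurableTypeR R) R).
Variables (mu : probability Omega R) (X : Omega -> R).
Notation leb := (@lebesgue_measure R).
Notation clift := (clift alpha).
Notation noise_avg := (noise_avg alpha theta).
Implicit Types (f g : R -> R) (a b x y t : R).

Hypothesis alpha1 : 1 <= alpha.
Hypothesis mX : measurable_fun setT X.
Hypothesis X01 : forall w, 0 <= X w <= 1.
Hypothesis eps_le_half : eps <= 2^-1.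
Hypothesis theta_leb : theta `<< lebesgue_measure.
Hypothesis theta_eps : theta [set t | eps < `|t|] = 0%E.
Hypothesis stationaryX : forall g, continuous g -> one_periodic g ->
  \int[theta]_t \int[mu]_w g (clift (X w) + t) = \int[mu]_w g (X w).

Notation transfer := (transfer alpha1).

Lemma clift_fpart g x t : one_periodic g -> 0 <= x <= 1 ->
  g (clift (fpart x) + t) = g (clift x + t).
Proof.
move=> pg; apply: (@comp_fpart_id _ (fun x => g (clift x + t))).
by rewrite clift0 clift1 add0r -(periodicDn pg 2 t) addrC.
Qed.

Lemma X_integrable g : continuous g -> one_periodic g ->
  mu.-integrable setT (EFin \o (g \o X)).
Proof.
move=> cg pg; have [M M0 gM] := periodic_bounded cg pg.
apply: (@bounded_integrable _ _ _ mu _ M) => [|x]; last exact: gM.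
by apply: measurableT_comp => //; exact: continuous_measurable_fun.
Qed.

Lemma stationary_noise_avg g : continuous g -> one_periodic g ->
  \int[mu]_w noise_avg g (X w) = \int[mu]_w g (X w).
Proof.
move=> cg pg; have [M M0 gM] := periodic_bounded cg pg.
rewrite -(stationaryX cg pg).
pose F (p : measurableTypeR R * Omega) := g (clift (X p.2) + p.1).
have mF : measurable_fun setT F.
  apply: measurableT_comp; first exact: continuous_measurable_fun.
  apply: measurable_funD; last exact: measurable_fst.
  apply: measurableT_comp; first by apply: continuous_measurable_fun; exact: continuous_clift.
  by apply: measurableT_comp; [exact: mX|exact: measurable_snd].
have FM p : `|F p| <= M by exact: gM.
have sw := Rintegral_swap theta mu mF FM.
rewrite -[RHS]/(\int[theta]_t \int[mu]_w F (t, w)) sw.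
apply: eq_Rintegral => w _; apply: eq_Rintegral => t _.
exact: clift_fpart.
Qed.

Lemma Rintegral_uniform f : continuous f -> (forall x, 0 <= f x) ->
  \int[uniform_prob (@ltr01 R)]_x f x = \int[leb]_(x in `[0, 1]) f x.
Proof.
move=> cf f0; rewrite /Rintegral integral_uniform//.
- by rewrite subr0 invr1 mul1e.
- by apply/measurable_EFinP; exact: continuous_measurable_fun.
Qed.

(** Exchange the two integrations.  For each noise value the inner integral is
    dualized by [transfer_duality], then translated by the noise value, which
    leaves the integral of a periodic function unchanged. *)
Lemma noise_duality (u psi g : R -> R) :
  continuous u -> u 0 = u 1 -> (forall x, 0 <= x <= 1 -> 0 <= u x) ->
  continuous psi -> one_periodic psi ->
  (forall y t, `|t| <= eps -> 0 <= y <= 1 ->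
    expR (psi (y + t)) * transfer u y <= u (fpart (y + t))) ->
  continuous g -> one_periodic g -> (forall x, 0 <= g x) ->
  \int[leb]_(x in `[0, 1]) (noise_avg (fun y => expR (psi y) * g y) x * u x) <=
  \int[leb]_(x in `[0, 1]) (g x * u x).
Proof.
move=> cu u01 u0 cpsi ppsi hpsi cg pg g0.
pose G y := expR (psi y) * g y.
have cG : continuous G.
  move=> y; apply: cvgM; last exact: cg.
  by apply: continuous_comp; [exact: cpsi|exact: continuous_expR].
have pG : one_periodic G by move=> y; rewrite /G ppsi pg.
have G0 y : 0 <= G y by rewrite mulr_ge0// expR_ge0.
pose U := u \o fpart.
have cU : continuous U by exact: continuous_fpart.
have pU : one_periodic U by exact: periodic_comp_fpart.
have U0 y : 0 <= U y by apply: u0; rewrite fpart_ge0 ltW// fpart_lt1.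
have cgU : continuous (fun x => g x * U x) by move=> x; apply: cvgM; [exact: cg|exact: cU].
have pgU : one_periodic (fun x => g x * U x) by move=> x; rewrite pg pU.
have uU x : 0 <= x <= 1 -> u x = U x by move=> x01; rewrite /U/= comp_fpart_id.
have [M M0 GM] := periodic_bounded cG pG.
have [N N0 UN] := periodic_bounded cU pU.
have IE : \int[leb]_(x in `[0, 1]) (g x * u x) = \int[leb]_(x in `[0, 1]) (g x * U x).
  by apply: eq_Rintegral => x; rewrite inE/= in_itv/= => x01; rewrite uU.
have I0 : 0 <= \int[leb]_(x in `[0, 1]) (g x * u x).
  by rewrite IE; apply: Rintegral_ge0 => x _; exact: mulr_ge0.
(* for an admissible noise value the transfer operator and the supersolution
   inequality apply *)
have inner t : `|t| <= eps ->
    \int[leb]_(x in `[0, 1]) (G (clift x + t) * u x) <=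
    \int[leb]_(x in `[0, 1]) (g x * u x).
  move=> te.
  rewrite (@transfer_duality _ _ alpha1 u (fun y => G (y + t)))//; last 2 first.
  - exact: continuous_translate.
  - by move=> x; rewrite addrAC pG.
  rewrite IE -(Rintegral_periodic_shift t cgU pgU).
  apply: le_Rintegral_itv.
  - move=> x; apply: cvgM; first exact: continuous_translate.
    exact: continuous_transfer.
  - exact: (@continuous_translate _ (fun x => g x * U x)).
  - move=> x x01; rewrite /G mulrAC mulrC ler_wpM2l//.
    exact: hpsi.
(* outside the unit interval, [x] is frozen so that the integrand is jointly
   measurable *)
pose F (p : measurableTypeR R * measurableTypeR R) :=
  G (clift (clamp p.2) + p.1) * u (clamp p.2).
have clc : continuous (fun x => clift (clamp x)).
  move=> x; apply: (@continuous_comp _ _ _ (@clamp R) clift).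
    exact: continuous_clamp.
  exact: continuous_clift.
have cuc : continuous (fun x => u (clamp x)).
  by move=> x; apply: (@continuous_comp _ _ _ (@clamp R) u); [exact: continuous_clamp|exact: cu].
have mF : measurable_fun setT F.
  apply: measurable_funM.
    apply: measurableT_comp; first exact: continuous_measurable_fun.
    apply: measurable_funD; last exact: measurable_fst.
    exact: (measurableT_comp (continuous_measurable_fun clc) measurable_snd).
  exact: (measurableT_comp (continuous_measurable_fun cuc) measurable_snd).
have F0 p : 0 <= F p by rewrite mulr_ge0// u0// clamp_itv.
have FM p : `|F p| <= M * N.
  by rewrite normrM uU ?clamp_itv//; exact: ler_pM.
have cF t : continuous (fun x => F (t, x)).
  move=> x; apply: cvgM; last exact: cuc.
  apply: (@continuous_comp _ _ _ (fun x => clift (clamp x)) (fun y => G (y + t))).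
    exact: clc.
  exact: continuous_translate.
have JE t : \int[uniform_prob (@ltr01 R)]_x F (t, x) =
    \int[leb]_(x in `[0, 1]) (G (clift x + t) * u x).
  rewrite Rintegral_uniform//; apply: eq_Rintegral => x; rewrite inE/= in_itv/= => x01.
  by rewrite /F/= clamp_id.
have -> : \int[leb]_(x in `[0, 1]) (noise_avg G x * u x) =
    \int[theta]_t \int[uniform_prob (@ltr01 R)]_x F (t, x).
  have E x : \int[theta]_t F (t, x) = noise_avg G (clamp x) * u (clamp x).
    transitivity ((\int[theta]_t G (clift (clamp x) + t)) * u (clamp x)).
      exact: (RintegralZr (u (clamp x)) measurableT
        (noise_integrable theta (clift (clamp x)) cG pG)).
    suff -> : noise_avg G (clamp x) = \int[theta]_t G (clift (clamp x) + t) by [].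
    rewrite /noise_avg; apply: eq_Rintegral => t _.
    by rewrite (clift_fpart t pG (clamp_itv x)).
  rewrite (Rintegral_swap theta (uniform_prob (@ltr01 R)) mF FM).
  rewrite Rintegral_uniform.
  - apply: eq_Rintegral => x; rewrite inE/= in_itv/= => x01.
    by rewrite E clamp_id.
  - have -> : (fun x => \int[theta]_t F (t, x)) =
        (fun x => noise_avg G (clamp x) * u (clamp x)) by apply/funext.
    move=> x; apply: cvgM; last exact: cuc.
    apply: (@continuous_comp _ _ _ (@clamp R) (noise_avg G)).
      exact: continuous_clamp.
    exact: continuous_noise_avg.
  - by move=> x; apply: Rintegral_ge0.
(* the other noise values form a null set *)
have mJ : measurable_fun setT (fun t => \int[uniform_prob (@ltr01 R)]_x F (t, x)).
  have mEF : measurable_fun setT (EFin \o F) by exact/measurable_EFinP.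
  have EF0 p : (0 <= (EFin \o F) p)%E by rewrite /= lee_fin.
  have mI := @measurable_fun_fubini_tonelli_F _ _ _ _ _ (uniform_prob (@ltr01 R))
    (EFin \o F) mEF EF0.
  exact: (measurableT_comp (fine_measurable measurableT) mI).
apply: (@Rintegral_le_cst_ae _ _ _ theta _ (M * N) _ [set t | eps < `|t|]) => //.
- move=> t; rewrite Rintegral_ge0//=.
  rewrite -(Rintegral_prob_cst (uniform_prob (@ltr01 R)) (M * N)).
  have iF : (uniform_prob (@ltr01 R)).-integrable setT (EFin \o (fun x => F (t, x))).
    apply: (@bounded_integrable _ _ _ (uniform_prob (@ltr01 R)) (fun x => F (t, x)) (M * N)).
      exact: (continuous_measurable_fun (cF t)).
    by move=> x; exact: FM.
  have iM : (uniform_prob (@ltr01 R)).-integrable setT (EFin \o cst (M * N)).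
    exact: (@bounded_integrable _ _ _ (uniform_prob (@ltr01 R)) (cst (M * N)) `|M * N|).
  apply: (le_Rintegral measurableT iF iM) => x _.
  exact: le_trans (ler_norm _) (FM _).
- exact: measurable_norm_gt.
- by move=> t /= /negP; rewrite -leNgt JE => /inner.
Qed.


(** Let [Phi n x] be the expectation of the product of the weights [exp psi]
    along [n] steps of the random orbit of [x].  By [noise_duality] its integral
    against [u] does not increase with [n], so that [Phi n] exceeds [exp (n c)]
    only on a set of exponentially small Lebesgue measure.  By Jensen's
    inequality and stationarity the mean of [ln (Phi n)] under the stationary
    measure is at least [n] times the mean [eta] of [psi].  If [eta > 0], then,
    averaging over one more step, the noise around some point gives a mass
    bounded below to the set where [Phi n] exceeds [exp (n eta / 2)], against
    [dominated_geometric]. *)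
Lemma entropy_inequality (u psi : R -> R) :
  continuous u -> u 0 = u 1 -> (forall x, 0 <= x <= 1 -> 1 <= u x) ->
  continuous psi -> one_periodic psi ->
  (forall y t, `|t| <= eps -> 0 <= y <= 1 ->
    expR (psi (y + t)) * transfer u y <= u (fpart (y + t))) ->
  \int[mu]_w psi (X w) <= 0.
Proof.
move=> cu u01 u1 cpsi ppsi hpsi.
have u0 x : 0 <= x <= 1 -> 0 <= u x by move=> /u1; exact: le_trans.
have [C C0 psiC] := periodic_bounded cpsi ppsi.
pose W g y := expR (psi y) * g y.
have cW g : continuous g -> continuous (W g).
  move=> cg y; apply: cvgM; last exact: cg.
  by apply: continuous_comp; [exact: cpsi|exact: continuous_expR].
have pW g : one_periodic g -> one_periodic (W g) by move=> pg y; rewrite /W ppsi pg.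
pose Phi n : R -> R := iter n (fun g => noise_avg (W g)) (cst 1).
have cpPhi n : continuous (Phi n) /\ one_periodic (Phi n).
  elim: n => [|n [cn pn]]; first by split=> // x; exact: cvg_cst.
  split; last exact: periodic_noise_avg.
  exact: (continuous_noise_avg alpha1 (cW _ cn) (pW _ pn)).
have cPhi n := (cpPhi n).1; have pPhi n := (cpPhi n).2.
have Phi_bounds n x : expR (- (n%:R * C)) <= Phi n x <= expR (n%:R * C).
  elim: n x => [|n IH] x; first by rewrite mul0r oppr0 expR0 lexx.
  have cst_cp (c : R) : continuous (cst c : R -> R) /\ one_periodic (cst c : R -> R).
    by split=> // z; exact: cvg_cst.
  have WE y : expR (- (n.+1%:R * C)) <= W (Phi n) y <= expR (n.+1%:R * C).
    have /andP[l r] := IH y; have := psiC y; rewrite ler_norml => /andP[p1 p2].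
    rewrite -natr1 mulrDl mul1r opprD addrC !expRD [expR (n%:R * C) * _]mulrC /W.
    by apply/andP; split; apply: ler_pM; rewrite ?expR_ge0 ?ler_expR//;
      apply: le_trans l; exact: expR_ge0.
  have [cW1 pW1] := (cW _ (cPhi n), pW _ (pPhi n)).
  have -> : Phi n.+1 x = noise_avg (W (Phi n)) x by [].
  apply/andP; split.
    rewrite -[leLHS](noise_avg_cst alpha theta _ x).
    apply: (@le_noise_avg _ _ _ (cst _) _ (cst_cp _).1 (cst_cp _).2 cW1 pW1).
    by move=> y; have /andP[] := WE y.
  rewrite -[leRHS](noise_avg_cst alpha theta _ x).
  apply: (@le_noise_avg _ _ _ _ (cst _) cW1 pW1 (cst_cp _).1 (cst_cp _).2).
  by move=> y; have /andP[] := WE y.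
have Phi0 n x : 0 < Phi n x.
  by have /andP[h _] := Phi_bounds n x; exact: lt_le_trans (expR_gt0 _) h.
pose L n x := ln (Phi n x).
have cL n : continuous (L n).
  move=> x; apply: (@continuous_comp _ _ _ (Phi n) (@ln R)); first exact: cPhi.
  exact: continuous_ln.
have pL n : one_periodic (L n) by move=> x; rewrite /L pPhi.
have LC n x : L n x <= n%:R * C.
  have /andP[_ h] := Phi_bounds n x.
  by rewrite -[leRHS]expRK ler_ln ?posrE ?expR_gt0.
have cpL n : continuous (fun y => psi y + L n y).
  by move=> y; apply: cvgD; [exact: cpsi|exact: cL].
have ppL n : one_periodic (fun y => psi y + L n y) by move=> y; rewrite ppsi pL.
have stepL n x : noise_avg (fun y => psi y + L n y) x <= L n.+1 x.
  rewrite -[leLHS]expRK ler_ln ?posrE ?expR_gt0//.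
  suff <- : noise_avg (expR \o (fun y => psi y + L n y)) x = Phi n.+1 x.
    exact: (jensen_noise_avg _ _ _ (cpL n) (ppL n)).
  rewrite -[RHS]/(noise_avg (W (Phi n)) x); congr (noise_avg _ x).
  by apply/funext => y; rewrite /= expRD lnK// posrE.
set eta := \int[mu]_w psi (X w).
have grow n : n%:R * eta <= \int[mu]_w L n (X w).
  elim: n => [|n IH].
    by rewrite mul0r /L /Phi/= ln1 Rintegral_prob_cst.
  apply: (@le_trans _ _ (\int[mu]_w noise_avg (fun y => psi y + L n y) (X w))).
    rewrite (stationary_noise_avg (cpL n) (ppL n)) RintegralD//; last 2 first.
    - exact: X_integrable cpsi ppsi.
    - exact: X_integrable (cL n) (pL n).
    by rewrite -natr1 mulrDl mul1r addrC lerD2l.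
  apply: le_Rintegral => //.
  - apply: X_integrable; last exact: periodic_noise_avg.
    exact: (continuous_noise_avg alpha1 (cpL n) (ppL n)).
  - exact: X_integrable (cL _) (pL _).
have mass n : \int[leb]_(x in `[0, 1]) Phi n x <= \int[leb]_(x in `[0, 1]) u x.
  have cPu k : continuous (fun x => Phi k x * u x).
    by move=> x; apply: cvgM; [exact: cPhi|exact: cu].
  apply: (@le_trans _ _ (\int[leb]_(x in `[0, 1]) (Phi n x * u x))).
    apply: le_Rintegral_itv => // x x01.
    by rewrite ler_peMr ?u1// ltW.
  elim: n => [|n IH].
    by apply: le_Rintegral_itv => // x _; rewrite mul1r.
  apply: le_trans IH; apply: noise_duality => //.
  by move=> x; exact: ltW.
rewrite leNgt; apply/negP => eta0.
pose E n c : set R := [set t | expR (n%:R * eta / 2) <= Phi n (c + t)].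
have mE n c : measurable (E n c).
  have cc : continuous (fun t => Phi n (t + c)) by exact: continuous_translate.
  have -> : E n c = setT `&` (fun t => Phi n (t + c)) @^-1` `[expR (n%:R * eta / 2), +oo[.
    by rewrite setTI; apply/seteqP; split => t /=; rewrite in_itv/= andbT /E/= addrC.
  exact: (continuous_measurable_fun cc).
pose b := eta / (4 * C).
have b0 : 0 < b by rewrite divr_gt0// mulr_gt0.
have m1E n c : measurable_fun setT (\1_(E n c) : R -> R).
  by apply: measurable_indic; exact: mE.
(* [ln (Phi n.+1)] is at most [n.+1 * C]: were the sets [E n.+1 c] all of
   probability less than [b], its noise averages would be at most
   [3/4 * n.+1 * eta] everywhere *)
have charged n : exists c, (b%:E <= theta (E n.+1 c))%E.
  apply: contrapT => /forallNP h.
  have small c : \int[theta]_t L n.+1 (c + t) <= n.+1%:R * eta * (3 / 4).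
    have Eb : fine (theta (E n.+1 c)) <= b.
      rewrite -lee_fin fineK; last by apply: fin_num_measure; exact: mE.
      by have /negP := h c; rewrite -ltNge => /ltW.
    have n0 : 0 < n.+1%:R * eta / 2 by rewrite divr_gt0// mulr_gt0.
    have nC0 : 0 <= n.+1%:R * C by rewrite mulr_ge0// ltW.
    pose h1 (t : R) : R := n.+1%:R * eta / 2 + n.+1%:R * C * \1_(E n.+1 c) t.
    apply: (@le_trans _ _ (\int[theta]_t h1 t)).
      apply: le_Rintegral => //; rewrite /h1.
      + exact: noise_integrable.
      + apply: (@bounded_integrable _ _ _ theta _ (n.+1%:R * eta / 2 + n.+1%:R * C)).
          by apply: measurable_funD => //; apply: measurable_funM => //; exact: m1E.
        move=> t; rewrite indicE ger0_norm; last first.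
          by rewrite addr_ge0 ?(ltW n0)// mulr_ge0.
        by rewrite lerD2l ler_piMr// lern1 leq_b1.
      + move=> t _; rewrite indicE; have [tE|tE] := boolP (t \in E n.+1 c).
          by rewrite mulr1 (le_trans (LC _ _))// lerDr ltW.
        rewrite mulr0 addr0 -[leRHS]expRK ler_ln ?posrE ?expR_gt0//.
        by move: tE; rewrite notin_setE /E/= => /negP; rewrite -ltNge => /ltW.
    rewrite RintegralD//; last 2 first.
    - exact: (@bounded_integrable _ _ _ theta (cst (n.+1%:R * eta / 2)) `|n.+1%:R * eta / 2|).
    - apply: (@bounded_integrable _ _ _ theta _ (n.+1%:R * C)).
        by apply: measurable_funM => //; exact: m1E.
      move=> t; rewrite indicE ger0_norm; last by rewrite mulr_ge0.
      by rewrite ler_piMr// lern1 leq_b1.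
    rewrite Rintegral_prob_cst RintegralZl//; last first.
      apply: (@bounded_integrable _ _ _ theta _ 1); first exact: m1E.
      by move=> t; rewrite indicE ger0_norm// lern1 leq_b1.
    have -> : \int[theta]_t \1_(E n.+1 c) t = fine (theta (E n.+1 c)).
      rewrite /Rintegral integral_indic//; last exact: mE.
      by congr (fine (theta _)); rewrite setIT.
    have : n.+1%:R * C * fine (theta (E n.+1 c)) <= n.+1%:R * C * b by rewrite ler_wpM2l.
    have -> : n.+1%:R * C * b = n.+1%:R * eta / 4.
      by rewrite /b; field; rewrite gt_eqF.
    lra.
  have := grow n.+1; apply/negP; rewrite -ltNge -(stationary_noise_avg (cL _) (pL _)).
  apply: (@le_lt_trans _ _ (\int[mu]_w (n.+1%:R * eta * (3 / 4)))).
    apply: le_Rintegral => //.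
    + apply: X_integrable; last exact: periodic_noise_avg.
      exact: (continuous_noise_avg alpha1 (cL _) (pL _)).
    + exact: (@bounded_integrable _ _ _ mu (cst (n.+1%:R * eta * (3 / 4)))
        `|n.+1%:R * eta * (3 / 4)|).
    + by move=> w _; exact: small.
  rewrite Rintegral_prob_cst; have : 0 < n.+1%:R * eta by rewrite mulr_gt0.
  lra.
have [c hc] := choice charged.
pose F n := `[- 2^-1, 2^-1] `&` E n.+1 (c n).
have mF n : measurable (F n) by apply: measurableI => //; exact: measurable_itv.
pose rho := expR (- (eta / 2)).
pose A := \int[leb]_(x in `[0, 1]) u x.
have A0 : 0 <= A by apply: Rintegral_ge0 => x/=; rewrite in_itv/= => /u0.
have rho01 : 0 <= rho < 1 by rewrite expR_ge0/= expR_lt1; lra.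
have lebF n : (leb (F n) <= (A * rho ^+ n)%:E)%E.
  have cc : continuous (fun t => Phi n.+1 (c n + t)).
    have -> : (fun t => Phi n.+1 (c n + t)) = (fun t => Phi n.+1 (t + c n)).
      by apply/funext => t; rewrite addrC.
    exact: continuous_translate.
  apply: le_trans (lebesgue_markov _ _ cc _ _) _.
  - by move=> t; exact: ltW.
  - exact: expR_gt0.
  have -> : \int[leb]_(t in `[- 2^-1, 2^-1]) Phi n.+1 (c n + t) =
            \int[leb]_(t in `[0, 1]) Phi n.+1 t.
    rewrite -(Rintegral_periodic_shift (c n - 2^-1) (cPhi _) (pPhi _)).
    transitivity (\int[leb]_(x in `[0, 1]) Phi n.+1 (c n + (x - 2^-1))).
      rewrite (@Rintegral_itv_shift _ (fun t => Phi n.+1 (c n + t)) 0 1 (- 2^-1))//.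
      by rewrite add0r; have -> : 1 - 2^-1 = 2^-1 :> R by lra.
    by apply: eq_Rintegral => x _; rewrite addrCA.
  rewrite lee_fin mulrC; apply: ler_pM; first by apply: Rintegral_ge0 => x _; exact: ltW.
  - by rewrite invr_ge0 expR_ge0.
  - exact: mass.
  rewrite -expRN /rho -expRM_natl ler_expR -natr1.
  have : 0 <= n%:R * eta by rewrite mulr_ge0// ltW.
  lra.
have [n] := @dominated_geometric _ _ _ theta leb F A rho b theta_leb mF rho01 A0 lebF b0.
apply/negP; rewrite -leNgt; apply: le_trans (hc n) _.
apply: (@le_trans _ _ (theta (F n `|` [set t | eps < `|t|]))).
  apply: le_measure; rewrite ?inE//; first exact: mE.
    by apply: measurableU; [exact: mF|exact: measurable_norm_gt].
  move=> t Et; have [te|te] := leP `|t| eps; last by right.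
  left; split => //=; rewrite in_itv/= -ler_norml.
  exact: le_trans te eps_le_half.
have := measureU2 theta (mF n) (measurable_norm_gt eps).
by rewrite [X in (_ + X)%E]theta_eps adde0.
Qed.

End entropy.

(** * Functions on the circle and the support of the noise *)

Section circle_functions.
Context {R : realType}.
Implicit Types (x y t : R) (g : R -> R) (p : circle R).

Local Notation coord := (@Defs.coord R).

Lemma coord_itv p : 0 <= coord p <= 1.
Proof. by have := set_valP (repr p); rewrite /unit_itv /= in_itv/=. Qed.

Lemma circle_ofD1 x : circle_of (x + 1) = circle_of x.
Proof.
by rewrite /circle_of; congr (\pi_(circle R) _); apply: val_inj; exact: fpartD1.
Qed.

Lemma fpart_circle_of x y : circle_of x = circle_of y -> fpart x = fpart y.
Proof.
move=> /eqmodP /= /orP[/eqP/(congr1 val)//|].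
have end0 z : endpoint (SigSub (frac_unit_itv z)) -> fpart z = 0.
  by move=> /orP[/eqP//|/eqP/= z1]; have := fpart_lt1 z; rewrite /fpart z1 ltxx.
by move=> /andP[/end0 -> /end0 ->].
Qed.

Lemma periodic_circle_of g x y t : one_periodic g -> circle_of x = circle_of y ->
  g (x + t) = g (y + t).
Proof.
move=> pg /fpart_circle_of xy.
have E z : g (z + t) = g (fpart z + t) by rewrite /fpart -mulrNz addrAC periodicDz.
by rewrite E xy -E.
Qed.

Lemma clamp_unit_itv x : clamp x \in @unit_itv R.
Proof. by rewrite inE /unit_itv/= in_itv/= clamp_itv. Qed.

Lemma continuous_circle_of (phi : circle R -> R) : continuous phi ->
  continuous (phi \o @circle_of R).
Proof.
move=> cphi.
pose i x : @unit_itv R := SigSub (clamp_unit_itv x).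
have ci : continuous i.
  apply: (@continuous_comp_initial _ _ _ (@set_val _ (@unit_itv R)) i).
  exact: continuous_clamp.
pose h x := phi (\pi_(circle R) (i x)).
have ch : continuous h.
  move=> x; apply: (@continuous_comp _ _ _ i (phi \o \pi_(circle R))); first exact: ci.
  by apply: (quotient_continuous phi).1.
have hE x : h x = phi (circle_of (clamp x)) by rewrite /h -circle_of_val.
have -> : phi \o @circle_of R = h \o @fpart R.
  apply/funext => x; rewrite /= hE clamp_id ?fpart_ge0 ?ltW ?fpart_lt1//.
  by congr phi; rewrite /circle_of; congr (\pi_(circle R) _); apply: val_inj => /=;
    rewrite -/(fpart (fpart x)) fpart_id// fpart_ge0 fpart_lt1.
apply: continuous_fpart => //.
by rewrite !hE !clamp_id ?lexx ?ler01// -[X in _ = phi (circle_of X)]add0r circle_ofD1.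
Qed.

Lemma coord_circle_of g x t : one_periodic g -> g (coord (circle_of x) + t) = g (x + t).
Proof. by move=> pg; apply: periodic_circle_of => //; exact: coordK. Qed.

Lemma continuous_coord g : continuous g -> one_periodic g -> continuous (g \o coord).
Proof.
move=> cg pg; apply/quotient_continuous.
have -> : (g \o coord) \o \pi_(circle R) = g \o (@set_val _ (@unit_itv R)).
  apply/funext => i /=; rewrite -circle_of_val.
  by have := coord_circle_of (val i) 0 pg; rewrite !addr0.
move=> i; apply: continuous_comp; last exact: cg.
exact: initial_continuous.
Qed.

Lemma continuous_circle_measurable (phi : circle R -> R) : continuous phi ->
  measurable_fun setT phi.
Proof.
move=> /continuousP cphi; apply: (measurability _ (RGenOInfty.measurableE R)) => //.
move=> _ [_ [a ->] <-]; rewrite setTI; apply: sub_sigma_algebra.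
by apply: cphi; exact: interval_open.
Qed.

(** The coordinate is continuous except at the base point, which is a measurable
    singleton. *)
Lemma measurable_coord : measurable_fun setT coord.
Proof.
pose O a : set (circle R) := [set p | 0 < coord p < 1 /\ a < coord p].
have val_coord (i : @unit_itv R) : 0 < val i < 1 -> coord (\pi_(circle R) i) = val i.
  move=> i01; rewrite -circle_of_val.
  have := fpart_circle_of (coordK (circle_of (val i))).
  rewrite [RHS]fpart_id; last by lra.
  have /andP[c0] := coord_itv (circle_of (val i)); rewrite le_eqVlt => /predU1P[->|c1].
    by rewrite fpart1; lra.
  by rewrite fpart_id// c0.
have oO a : open (O a).
  rewrite /open/= /quotient_open.
  have -> : \pi_(circle R) @^-1` O a =
      (@set_val _ (@unit_itv R)) @^-1` (`]0, 1[ `&` `]a, +oo[).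
    apply/seteqP; split => i /=; rewrite /O/= !in_itv/= andbT.
      move=> [c01 ac].
      have i01 : 0 < val i < 1.
        have ci := fpart_circle_of (coordK (circle_of (val i))).
        rewrite circle_of_val [LHS]fpart_id in ci; last by lra.
        rewrite ci in c01.
        have := set_valP i; rewrite /unit_itv /= in_itv/= => /andP[i0].
        rewrite le_eqVlt => /predU1P[i1|i1]; last first.
          by move: c01; rewrite fpart_id// i0.
        have f0 : fpart (val i) = 0 by rewrite (i1 : val i = 1) fpart1.
        by move: c01; rewrite f0 ltxx.
      by split; [exact: i01|rewrite (val_coord i i01) in ac].
    by move=> [i01 ai]; rewrite val_coord.
  apply: (continuousP _).1 => //; first exact: initial_continuous.
  by apply: openI; [exact: interval_open|exact: interval_open].
have mO a : measurable (O a) by apply: sub_sigma_algebra; exact: oO.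
apply: (measurability _ (RGenOInfty.measurableE R)) => //.
move=> _ [_ [a ->] <-]; rewrite setTI.
pose base := ~` O (-1).
have mb : measurable base by exact: measurableC.
have baseE p q : base p -> base q -> p = q.
  have e r : base r -> r = circle_of 0.
    rewrite /base/= /O/= => /not_andP h.
    have /andP[r0 r1] := coord_itv r.
    have [c0|c0] := eqVneq (coord r) 0; first by rewrite -[LHS]coordK c0.
    have [c1|c1] := eqVneq (coord r) 1.
      by rewrite -[LHS]coordK c1 -[1]add0r circle_ofD1.
    exfalso; case: h => h; apply: h; last by lra.
    by rewrite !lt_neqAle r0 r1 c1 eq_sym c0.
  by move=> /e -> /e ->.
have -> : coord @^-1` `]a, +oo[ = O a `|` (base `&` coord @^-1` `]a, +oo[).
  apply/seteqP; split => p /=.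
    move=> ap; have [bp|/contrapT[p01 _]] := pselect (base p); first by right.
    by left; split => //; move: ap; rewrite in_itv/= andbT.
  by case=> [[_ ap]|[_]//]; rewrite in_itv/= ap.
apply: measurableU => //.
have [[p [bp ap]]|h] := pselect (exists p, (base `&` coord @^-1` `]a, +oo[) p).
  suff -> : base `&` coord @^-1` `]a, +oo[ = base by [].
  by apply/seteqP; split => [q []//|q bq]; split => //; rewrite (baseE q p).
suff -> : base `&` coord @^-1` `]a, +oo[ = set0 by exact: measurable0.
by apply/seteqP; split => // q bq; apply: h; exists q.
Qed.

Lemma clift_intermittent (alpha x : R) : 1 <= alpha -> 0 <= x <= 1 ->
  circle_of (clift alpha x) = circle_of (intermittent_fun alpha x).
Proof.
move=> a1 /andP[x0 x1]; rewrite /intermittent_fun; case: ifPn => x2.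
  by rewrite clift_left ?ltW// /branch mulrDr mulr1 excessE.
rewrite -leNgt in x2; rewrite clift_right// circle_ofD1; congr circle_of.
by rewrite /branch mulrDr mulr1 excessE ?subr_ge0//; lra.
Qed.

Lemma stationary_coord (alpha : R) (theta : probability (measurableTypeR R) R)
    (mu : probability (circle R) R) g :
  1 <= alpha -> stationary theta (additive_perturbation alpha) mu ->
  continuous g -> one_periodic g ->
  \int[theta]_t \int[mu]_p g (clift alpha (coord p) + t) = \int[mu]_p g (coord p).
Proof.
move=> a1 st cg pg; rewrite -(st _ (continuous_coord cg pg)).
apply: eq_Rintegral => t _; apply: eq_Rintegral => p _ /=.
rewrite /additive_perturbation -[in RHS](addr0 (coord _)).
rewrite coord_circle_of// addr0 /intermittent coord_circle_of//.
by apply: periodic_circle_of => //; apply: clift_intermittent => //; exact: coord_itv.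
Qed.

End circle_functions.

Section support.
Context {R : realType}.

(** The complement of the support is covered by the countably many null intervals
    with rational endpoints. *)
Lemma msupport_null (theta : probability (measurableTypeR R) R) (e : R) :
  msupport theta `<=` `[- e, e] -> theta [set t | e < `|t|] = 0%E.
Proof.
move=> supp.
pose I (pq : rat * rat) : set R := `]ratr pq.1, ratr pq.2[%classic.
pose F n : set R := if unpickle n is Some pq then
  (if theta (I pq) == 0%E then I pq else set0) else set0.
have mF n : measurable (F n).
  by rewrite /F; case: unpickle => [pq|//]; case: ifPn => // _; exact: measurable_itv.
have F0 n : theta (F n) = 0%E.
  rewrite /F; case: unpickle => [pq|]; last exact: measure0.
  by case: ifPn => [/eqP//|_]; exact: measure0.
apply/eqP; rewrite eq_le measure_ge0 andbT.
apply: (@le_trans _ _ (theta (\bigcup_n F n))).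
  apply: le_measure; rewrite ?inE; first exact: measurable_norm_gt.
    by apply: bigcup_measurable => k _; exact: mF.
  move=> t /= et.
  have : ~ msupport theta t.
    move=> /supp /=; rewrite in_itv/= -ler_norml; lra.
  move=> /existsNP[U /not_implyP[oU /not_implyP[Ut /negP]]].
  rewrite -leNgt => U0.
  have [r/= r0 rU] : nbhs_ball t U.
    by apply/nbhs_ballP; exact: open_nbhs_nbhs.
  have /rat_in_itvoo[a] : t - r < t by rewrite ltrBlDr ltrDl.
  rewrite in_itv/= => /andP[a1 a2].
  have /rat_in_itvoo[b] : t < t + r by rewrite ltrDl.
  rewrite in_itv/= => /andP[b1 b2].
  have Iab : theta (I (a, b)) == 0%E.
    rewrite eq_le measure_ge0 andbT (le_trans _ U0)//.
    apply: le_measure; rewrite ?inE.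
    - exact: measurable_itv.
    - exact: open_measurable.
    - move=> s; rewrite /I/= in_itv/= => /andP[s1 s2]; apply: rU.
      by rewrite /ball/= ltr_norml; lra.
  have FE : F (pickle (a, b)) = I (a, b) by rewrite /F (@pickleK _ (a, b)) Iab.
  exists (pickle (a, b)); first exact: Logic.I.
  by rewrite FE /I/= in_itv/= a2.
have mU : measurable (\bigcup_n F n).
  by apply: bigcup_measurable => k _; exact: mF.
have := measure_sigma_subadditive theta mF mU (@subset_refl _ _).
by rewrite eseries0// => k _ _; exact: F0.
Qed.

End support.

(** * Small noise *)

Section small_noise.
Context {R : realType}.
Variable alpha : R.
Hypothesis alpha1 : 1 <= alpha.

Lemma continuous_inv_fpart (u : R -> R) : continuous u -> u 0 = u 1 ->
  (forall x, 0 <= x <= 1 -> 1 <= u x) -> continuous (fun y => (u (fpart y))^-1).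
Proof.
move=> cu u01 u1 y; apply: cvgV; last exact: (continuous_fpart cu u01).
by rewrite gt_eqF// (lt_le_trans ltr01)// u1// fpart_ge0 ltW// fpart_lt1.
Qed.

(** Uniform continuity of the periodic extension of [u] costs at most [1/4] of the
    margin [1/2]; the rest pays for the factor [exp (1 / (4 u))], by
    [1 - x <= exp (- x)]. *)
Lemma supersolution_noise (s : R) (u : R -> R) : 0 < s ->
  continuous u -> u 0 = u 1 ->
  (forall x, 0 <= x <= 1 -> 1 <= u x) ->
  (forall x, 0 <= x <= 1 -> s * transfer alpha1 u x <= u x - 2^-1) ->
  exists2 e0, 0 < e0 & forall y t, `|t| <= e0 -> 0 <= y <= 1 ->
    expR (ln s + (4 * u (fpart (y + t)))^-1) * transfer alpha1 u y <= u (fpart (y + t)).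
Proof.
move=> s0 cu u01 u1 su.
pose U := u \o @fpart R.
have cU : continuous U by exact: continuous_fpart.
have pU : one_periodic U by exact: periodic_comp_fpart.
have U1 y : 1 <= U y by apply: u1; rewrite fpart_ge0 ltW// fpart_lt1.
have [e0 e00 he0] := periodic_unif_continuous cU pU (e := 4^-1) ltac:(lra).
exists e0 => // y t te y01; rewrite -/(U (y + t)).
have hU : s * transfer alpha1 u y <= U (y + t) - 4^-1.
  have := su y y01; have -> : u y = U y by rewrite /U/= comp_fpart_id.
  by have := he0 y t te; rewrite ltr_norml; lra.
set v := U (y + t) in hU *.
have v1 : 1 <= v by exact: U1.
rewrite expRD lnK ?posrE// mulrAC mulrC.
apply: le_trans (ler_wpM2l (expR_ge0 _) hU) _.
have -> : v - 4^-1 = v * (1 - (4 * v)^-1).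
  by rewrite mulrBr mulr1 invfM mulrCA divff ?mulr1// gt_eqF; lra.
have h : 1 - (4 * v)^-1 <= expR (- (4 * v)^-1).
  by have := expR_ge1Dx (- (4 * v)^-1); lra.
rewrite mulrCA -[leRHS]mulr1 ler_pM2l; last by lra.
apply: le_trans (ler_wpM2l (expR_ge0 _) h) _.
by rewrite -expRD subrr expR0.
Qed.

(** The entropy inequality for [psi = ln s + 1 / (4 u)]. *)
Lemma mass_away (d : measure_display) (Omega : measurableType d)
    (mu : probability Omega R) (X : Omega -> R) (eps s : R) (u : R -> R)
    (theta : probability (measurableTypeR R) R) :
  measurable_fun setT X -> (forall w, 0 <= X w <= 1) -> eps <= 2^-1 ->
  theta `<< lebesgue_measure -> theta [set t | eps < `|t|] = 0%E ->
  (forall g, continuous g -> one_periodic g ->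
    \int[theta]_t \int[mu]_w g (clift alpha (X w) + t) = \int[mu]_w g (X w)) ->
  continuous u -> u 0 = u 1 -> (forall x, 0 <= x <= 1 -> 1 <= u x) ->
  (forall y t, `|t| <= eps -> 0 <= y <= 1 ->
    expR (ln s + (4 * u (fpart (y + t)))^-1) * transfer alpha1 u y <= u (fpart (y + t))) ->
  \int[mu]_w (u (fpart (X w)))^-1 <= 4 * - ln s.
Proof.
move=> mX X01 e2 tl te st cu u01 u1 hu.
pose V y := (u (fpart y))^-1.
have cV : continuous V := continuous_inv_fpart cu u01 u1.
have pV : one_periodic V by move=> y; rewrite /V fpartD1.
pose psi y := ln s + 4^-1 * V y.
have cpsi : continuous psi.
  by move=> y; apply: cvgD; [exact: cvg_cst|apply: cvgM; [exact: cvg_cst|exact: cV]].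
have ppsi : one_periodic psi by move=> y; rewrite /psi pV.
have hpsi y t : `|t| <= eps -> 0 <= y <= 1 ->
    expR (psi (y + t)) * transfer alpha1 u y <= u (fpart (y + t)).
  by move=> te' y01; rewrite /psi /V -invfM; exact: hu.
have := entropy_inequality mX X01 e2 tl te st cu u01 u1 cpsi ppsi hpsi.
have iV := X_integrable mu mX cV pV.
rewrite RintegralD//; last 2 first.
- exact: (@bounded_integrable _ _ _ mu (cst (ln s)) `|ln s|).
- exact: (integrableZl _ 4^-1 iV).
rewrite Rintegral_prob_cst RintegralZl//.
rewrite -/V; lra.
Qed.

End small_noise.

Unset Implicit Arguments.

Theorem theorem2 (R : realType) (alpha : R)
    (theta : R -> probability (measurableTypeR R) R)
    (mu : R -> probability (circle R) R) :
  1 <= alpha ->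
  (forall eps : R, 0 < eps <= 2^-1 -> theta eps `<< lebesgue_measure) ->
  (forall eps : R, 0 < eps <= 2^-1 -> msupport (theta eps) `<=` `[- eps, eps]) ->
  (forall eps : R, 0 < eps <= 2^-1 ->
    stationary (theta eps) (additive_perturbation alpha) (mu eps)) ->
  weak_star_cvg 0^'+ mu \d_(circle_of 0).
Proof.
move=> alpha1 theta_leb theta_supp stat phi cphi.
pose g := phi \o @circle_of R.
have cg : continuous g by exact: continuous_circle_of.
have pg : one_periodic g by move=> x; rewrite /g/= circle_ofD1.
have phiE p : phi p = g (Defs.coord p) by rewrite /g/= coordK.
have -> : \int[\d_(circle_of 0)]_p phi p = g 0.
  rewrite /Rintegral integral_dirac//; first by rewrite diracT mul1e.
  by apply/measurable_EFinP; exact: continuous_circle_measurable.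
apply/cvgrPdist_le => gamma gamma0.
have [M M0 gM] := periodic_bounded cg pg.
have [d d0 hd] := periodic_unif_continuous cg pg (e := gamma / 2) ltac:(lra).
pose eta := gamma / (32 * M).
have eta0 : 0 < eta by rewrite divr_gt0// mulr_gt0.
have [s [u [/andP[s2 s1] [cu u01] u1 su ud]]] := supersolution alpha1 d0 eta0.
have s0 : 0 < s by lra.
have [e0 e00 hu] := supersolution_noise s0 cu u01 u1 su.
near=> eps.
have eps0 : 0 < eps by near: eps; exact: nbhs_right_gt.
have eps2 : eps <= 2^-1 by near: eps; apply: nbhs_right_le; lra.
have epse : eps <= e0 by near: eps; exact: nbhs_right_le.
have eps02 : 0 < eps <= 2^-1 by rewrite eps0.
have mu_u : \int[mu eps]_p (u (fpart (Defs.coord p)))^-1 <= 4 * - ln s.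
  apply: (@mass_away _ _ alpha1 _ _ _ _ eps s u (theta eps)) => //.
  - exact: measurable_coord.
  - exact: coord_itv.
  - exact: theta_leb.
  - by apply: msupport_null; exact: theta_supp.
  - by move=> f cf pf; apply: stationary_coord => //; exact: stat.
  - by move=> y t te; apply: hu; exact: le_trans te epse.
have lns : - ln s <= 2 * (1 - s).
  have := expR_ge1Dx (- ln s); rewrite expRN lnK ?posrE//.
  have : s^-1 <= 1 + 2 * (1 - s).
    rewrite -[leLHS]mul1r ler_pdivrMr//.
    have : 0 <= (1 - s) * (2 * s - 1) by apply: mulr_ge0; lra.
    lra.
  lra.
pose K := 2 * M * eta / (1 - s).
have K0 : 0 <= K.
  by apply: divr_ge0; [apply: mulr_ge0; [apply: mulr_ge0|]; exact: ltW|lra].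
(* near the neutral point [phi] is close to its value there, elsewhere
   [K / u >= 2 * M] because [(1 - s) * u <= eta] *)
have pointwise p : `|g (Defs.coord p) - g 0| <= gamma / 2 + K * (u (fpart (Defs.coord p)))^-1.
  have x01 := coord_itv p; move: (Defs.coord p) x01 => x x01.
  rewrite (comp_fpart_id u01 x01).
  have ux : 0 < u x by apply: lt_le_trans (u1 x x01).
  have Ku : 0 <= K * (u x)^-1 by rewrite mulr_ge0// invr_ge0 ltW.
  have [xd|xd] := leP x d.
    apply: (@le_trans _ _ (gamma / 2)); last by rewrite lerDl.
    by have := hd 0 x; rewrite add0r ger0_norm; [move=> /(_ xd)/ltW|lra].
  have [dx|dx] := leP (1 - d) x.
    apply: (@le_trans _ _ (gamma / 2)); last by rewrite lerDl.
    have := hd 0 (x - 1); rewrite add0r ler0_norm; last by lra.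
    have -> : g (x - 1) = g x by rewrite -[LHS]pg subrK.
    by rewrite opprB => h; apply/ltW/h; lra.
  have hx : (1 - s) * u x <= eta by apply: ud; lra.
  apply: (@le_trans _ _ (2 * M)).
    by apply: le_trans (ler_normB _ _) _; have := gM x; have := gM 0; lra.
  have : 2 * M <= K * (u x)^-1.
    rewrite ler_pdivlMr// /K ler_pdivlMr; last by lra.
    by rewrite -mulrA ler_pM2l ?mulr_gt0// mulrC.
  by move=> h; apply: le_trans h _; rewrite lerDr; lra.
have icst (c : R) : (mu eps).-integrable setT (EFin \o cst c).
  exact: (@bounded_integrable _ _ _ (mu eps) (cst c) `|c|).
have ig : (mu eps).-integrable setT (EFin \o (g \o @Defs.coord R)).
  exact: (X_integrable (mu eps) (@measurable_coord R) cg pg).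
have iu : (mu eps).-integrable setT (EFin \o (fun p => (u (fpart (Defs.coord p)))^-1)).
  apply: (X_integrable (mu eps) (@measurable_coord R) (continuous_inv_fpart cu u01 u1)).
  by move=> y; rewrite fpartD1.
have iKu := integrableZl measurableT K iu.
have -> : \int[mu eps]_p phi p = \int[mu eps]_p g (Defs.coord p).
  by apply: eq_Rintegral => p _; exact: phiE.
rewrite distrC -(Rintegral_prob_cst (mu eps) (g 0)) -RintegralB//; last exact: icst.
apply: le_trans (le_normr_Rintegral measurableT (integrableB measurableT ig (icst _))) _.
apply: (@le_trans _ _ (\int[mu eps]_p (gamma / 2 + K * (u (fpart (Defs.coord p)))^-1))).
  apply: le_Rintegral => //.
  - exact: (integrable_norm (integrableB measurableT ig (icst _))).
  - exact: (integrableD measurableT (icst _) iKu).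
  - by move=> p _; exact: pointwise.
rewrite (RintegralD measurableT (icst (gamma / 2)) iKu).
rewrite (Rintegral_prob_cst (mu eps) (gamma / 2)) (RintegralZl K measurableT iu).
have : K * \int[mu eps]_p (u (fpart (Defs.coord p)))^-1 <= K * (4 * (2 * (1 - s))).
  by apply: ler_wpM2l => //; apply: le_trans mu_u _; lra.
have -> : K * (4 * (2 * (1 - s))) = gamma / 2.
  by rewrite /K /eta; field; rewrite !gt_eqF//; lra.
lra.
Unshelve. all: by end_near. Qed.
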